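(* Let $\beta>0$, $L>0$ and $x_0\neq0$. Assume $\Delta=\Delta(n)$ satisfies $\Delta=O(1)$ and $\Delta^{-1}=O(n)$. There exists $C>0$ such that for $n$ large enough and for any estimator $\hat g_n(x_0)$ (measurable function of the observations $Z_1^\Delta,\dots,Z_n^\Delta$), $$\sup_{g\in\mathcal H(\beta,L)}\mathbb E_g\big[(\hat g_n(x_0)-g(x_0))^2\big]\ge C(n\Delta)^{-\frac{2\beta}{2\beta+1}},$$ where the supremum is over functions $g\in\mathcal H(\beta,L)$ of the form $g(x)=xN(x)$ with $N$ a Lévy density such that $g$ is integrable, and $\mathbb E_g$ denotes expectation when $Z_k^\Delta$ are the increments of the corresponding Lévy process.
   Context: For a Lévy density $N$ with $g(x)=xN(x)$ integrable, $(L_t)$ denotes the real-valued pure-jump Lévy process with characteristic function $\mathbb{E}[e^{iuL_t}]=\exp\big(t\int_{\mathbb R}(e^{iux}-1)N(x)dx\big)$, observed at times $k\Delta$, $k=1,\dots,n$, with increments $Z_k^\Delta=L_{k\Delta}-L_{(k-1)\Delta}$. For $\beta>0$, $\lfloor\beta\rfloor$ is the largest integer strictly smaller than $\beta$. Hölder class $\mathcal H(\beta,L)$ ($l=\lfloor\beta\rfloor$): functions $f:\mathbb R\to\mathbb R$ whose derivative $f^{(l)}$ exists and satisfies $|f^{(l)}(x)-f^{(l)}(y)|\le L|x-y|^{\beta-l}$ for all $x,y\in\mathbb R$. *)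

(* Defs.v *)
From HB Require Import structures.
From mathcomp Require Import all_boot all_order all_algebra.
From mathcomp Require Import all_classical all_reals all_analysis.
Set Implicit Arguments. Unset Strict Implicit. Unset Printing Implicit Defensive.
Import Order.TTheory GRing.Theory Num.Theory.
Import numFieldNormedType.Exports.
Local Open Scope classical_set_scope.
Local Open Scope ring_scope.

Section Defs.
Variable R : realType.

Notation leb := (@lebesgue_measure R).

(* floor-strict: the largest integer strictly smaller than beta (beta > 0) *)
Definition lfloor (beta : R) : nat := `|Num.ceil beta - 1|%N.

Definition holder_class (beta L : R) (f : R -> R) : Prop :=
  (forall k : nat, (k < lfloor beta)%N -> forall x : R, derivable (derive1n k f) x 1)
  /\ forall x y : R,
       `|derive1n (lfloor beta) f x - derive1n (lfloor beta) f y|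
         <= L * `|x - y| `^ (beta - (lfloor beta)%:R).

Definition levy_density (N : R -> R) : Prop :=
  measurable_fun setT N /\ (forall x, 0 <= N x) /\
  leb.-integrable setT (fun x => (Num.min 1 (x ^+ 2) * N x)%:E).

Definition admissible (beta L : R) (N : R -> R) : Prop :=
  levy_density N /\ leb.-integrable setT (fun x => (x * N x)%:E) /\
  holder_class beta L (fun x => x * N x).

(* P is the law of L_Delta, i.e. its characteristic function is
   exp(Delta * \int (e^{iux} - 1) N(x) dx), written via real and imaginary parts:
   with a(u) = \int (cos(ux) - 1) N(x) dx and b(u) = \int sin(ux) N(x) dx,
   \int e^{iux} P(dx) = e^{Delta a(u)} (cos (Delta b(u)) + i sin(Delta b(u))). *)
Definition levy_increment_law (Delta : R) (N : R -> R) (P : probability R R) : Prop :=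
  forall u : R,
    let a := Rintegral leb setT (fun x => (cos (u * x) - 1) * N x) in
    let b := Rintegral leb setT (fun x => sin (u * x) * N x) in
    Rintegral P setT (fun x => cos (u * x)) = expR (Delta * a) * cos (Delta * b) /\
    Rintegral P setT (fun x => sin (u * x)) = expR (Delta * a) * sin (Delta * b).

(* Expectation of a nonnegative function of n i.i.d. observations with law P,
   as the iterated integral (= integral against the product measure P^{(x) n},
   by Tonelli, for measurable h). *)
Fixpoint iid_expect (P : probability R R) (n : nat) : (n.-tuple R -> \bar R) -> \bar R :=
  match n with
  | 0 => fun h => h [tuple]
  | m.+1 => fun h => (\int[P]_z iid_expect P (fun t : m.-tuple R => h [tuple of z :: t]))%E
  end.

End Defs.

(* Main.v *)
Require Import Defs.
From HB Require Import structures.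
From mathcomp Require Import all_boot all_order all_algebra.
From mathcomp Require Import all_classical all_reals all_analysis.
From mathcomp Require Import finmap measurable_realfun ring lra.
Set Implicit Arguments.
Unset Strict Implicit.
Unset Printing Implicit Defensive.
Import Order.TTheory GRing.Theory Num.Theory.
Import numFieldNormedType.Exports.
Local Open Scope classical_set_scope.
Local Open Scope ring_scope.

(** Le Cam's two-point method.  Take a fixed bump g0 around x0 and
    g1 = g0 + a bump of width h and height of order h^beta, with
    h of order (n Delta)^(-1/(2 beta + 1)); both lie in the Hölder class and have
    finite Lévy measures N0, N1, so the increments are compound Poisson.
    Iterating Cauchy-Schwarz over the jumps and summing over their number gives,
    for nonnegative f,
      (E_1 f)^2 <= exp(Delta * \int (N1 - N0)^2 / N0) * E_0 (f^2),
    an inequality that tensorizes over the n observations; its constant stays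
    bounded because n Delta h^(2 beta + 1) does.  The law of an increment is
    only known through its characteristic function, so it is first
    identified with the compound Poisson law by Lévy's uniqueness theorem, proved
    here by smoothing with the Cauchy kernel. *)

(** * Functionals that are integrals against a measure *)

(** Since [x0 != 0], a bump of half-width at most |x0| / 2 stays away from 0, so g(x) / x is bounded
    with compact support, hence a finite density; giving the bump the sign of [x0] makes that
    density nonnegative. The chi-square term divides by N0, so the perturbation has to sit where N0
    is bounded below: it has the same centre and at most half the width. The term is then at most of
    order h^beta * h^beta * h, squared height times width, while the risk is of the order of the
    squared height h^(2 beta); keeping n Delta h^(2 beta + 1) bounded gives the rate. A compound
    Poisson law has an atom at 0 (no jump), so increment laws have no Lebesgue densities to compare.
    The comparison is therefore an inequality between expectations of an arbitrary nonnegative f,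
    without a likelihood ratio. Cauchy-Schwarz is used in the linear form 2 a <= t K + b / t for all
    t > 0, which can be integrated or summed term by term and stays meaningful for infinite
    values. *)

Section sigma_functional.
Context d (T : measurableType d) (R : realType).
Local Open Scope ereal_scope.
Implicit Types (f g h : T -> \bar R) (J : (T -> \bar R) -> \bar R).

Definition nnmeas h := measurable_fun setT h /\ forall x, 0 <= h x.

(* Stated for functionals rather than measures so that iterated and weighted integrals
   (compound Poisson laws, product laws) need no kernel or density construction. *)
Record sigma_functional J : Prop := SigmaFunctional {
  sf_ge0 : forall h, nnmeas h -> 0 <= J h;
  sf_scale : forall (c : R) h, (0 <= c)%R -> nnmeas h ->
    J (fun x => c%:E * h x) = c%:E * J h;
  sf_add : forall f g, nnmeas f -> nnmeas g ->
    J (fun x => f x + g x) = J f + J g;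
  sf_series : forall h : nat -> T -> \bar R, (forall n, nnmeas (h n)) ->
    J (fun x => \sum_(0 <= n <oo) h n x) = \sum_(0 <= n <oo) J (h n) }.

Lemma nnmeas_cst (c : \bar R) : 0 <= c -> nnmeas (fun=> c).
Proof. by move=> c0; split => //; exact: measurable_cst. Qed.

Lemma nnmeas_scale (c : R) h : (0 <= c)%R -> nnmeas h ->
  nnmeas (fun x => c%:E * h x).
Proof.
move=> c0 [mh h0]; split; first exact: measurable_funeM.
by move=> x; rewrite mule_ge0.
Qed.

Lemma nnmeas_mul f g : nnmeas f -> nnmeas g -> nnmeas (fun x => f x * g x).
Proof.
move=> [mf f0] [mg g0]; split; first exact: emeasurable_funM.
by move=> x; rewrite mule_ge0.
Qed.

Lemma nnmeas_sum n (h : nat -> T -> \bar R) : (forall i, nnmeas (h i)) ->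
  nnmeas (fun x => \sum_(i < n) h i x).
Proof.
move=> mh; split; first by apply: emeasurable_sum => i; exact: (mh i).1.
by move=> x; apply: sume_ge0 => i _; exact: (mh i).2.
Qed.

Lemma nnmeas_indic (A : set T) : measurable A ->
  nnmeas (fun x => (\1_A x)%:E : \bar R).
Proof.
move=> mA; split; first exact/measurable_EFinP/measurable_indic.
by move=> x; rewrite lee_fin.
Qed.

Lemma sf_cst0 J : sigma_functional J -> J (fun=> 0) = 0.
Proof.
move=> sJ; have := sf_scale sJ (lexx 0%R) (nnmeas_cst (lexx 0)).
by rewrite !mul0e.
Qed.

Lemma sf_sum J n (h : nat -> T -> \bar R) : sigma_functional J ->
  (forall i, nnmeas (h i)) ->
  J (fun x => \sum_(i < n) h i x) = \sum_(i < n) J (h i).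
Proof.
move=> sJ mh; elim: n => [|n IH].
  rewrite big_ord0 -[RHS](sf_cst0 sJ); congr J.
  by apply/funext => x; rewrite big_ord0.
rewrite big_ord_recr/= -IH -sf_add //; last exact: nnmeas_sum.
by congr J; apply/funext => x; rewrite big_ord_recr.
Qed.

Lemma sigma_functional_integral (m : {measure set T -> \bar R}) :
  sigma_functional (fun h => \int[m]_x h x).
Proof.
split.
- by move=> h [_ h0]; exact: integral_ge0.
- by move=> c h c0 [mh h0]; rewrite ge0_integralZl_EFin.
- by move=> f g [mf f0] [mg g0]; rewrite ge0_integralD.
- by move=> h mh; rewrite integral_nneseries// => n; [exact: (mh n).1|move=> x _; exact: (mh n).2].
Qed.

Import HBSimple HBNNSimple.

Lemma sf_ext_sfun J J' (f : {sfun T >-> R}) : sigma_functional J ->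
  sigma_functional J' ->
  (forall A, measurable A -> J (fun x => (\1_A x)%:E) = J' (fun x => (\1_A x)%:E)) ->
  (forall x, (0 <= f x)%R) ->
  J (fun x => (f x)%:E) = J' (fun x => (f x)%:E).
Proof.
move=> sJ sJ' JJ' f0.
set s := fset_set (f @` setT).
have s0 i : (i < #|`s|)%N -> (0 <= s`_i)%R.
  move=> /(mem_nth 0%R); rewrite in_fset_set; last exact: fimfunP.
  by move=> /set_mem[x _ <-].
(* Padded with 0 to a family over all of [nat], the index type that [sf_sum] takes. *)
pose h (i : nat) (x : T) : \bar R :=
  if (i < #|`s|)%N then (s`_i)%:E * (\1_(f @^-1` [set s`_i]) x)%:E else 0.
have mA i : measurable (f @^-1` [set s`_i]).
  exact: measurable_funPTI.
have mh i : nnmeas (h i).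
  rewrite /h; case: ltnP => [/s0 si|_]; last exact: nnmeas_cst.
  exact/nnmeas_scale/nnmeas_indic.
have -> : (fun x => (f x)%:E) = (fun x => \sum_(i < #|`s|) h i x).
  apply/funext => x; rewrite fimfunEord -sumEFin; apply: eq_bigr => i _.
  by rewrite /h ltn_ord EFinM.
rewrite (sf_sum _ sJ)// (sf_sum _ sJ')//; apply: eq_bigr => i _.
rewrite /h ltn_ord (sf_scale sJ) ?(sf_scale sJ') ?JJ'//; try exact: s0.
all: exact: nnmeas_indic.
Qed.

(** The increments of the simple approximations are nonnegative simple functions summing to [h], so
    [sf_series] stands in for monotone convergence. *)
Lemma sf_ext J J' : sigma_functional J -> sigma_functional J' ->
  (forall A, measurable A -> J (fun x => (\1_A x)%:E) = J' (fun x => (\1_A x)%:E)) ->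
  forall h, nnmeas h -> J h = J' h.
Proof.
move=> sJ sJ' JJ' h [mh h0].
pose s := nnsfun_approx measurableT mh.
pose dlt (n : nat) : {sfun T >-> R} :=
  if n is m.+1 then (s m.+1 \- s m : {sfun T >-> R})%R else s 0%N.
have d0 n x : (0 <= dlt n x)%R.
  case: n => [|n] /=; first exact: fun_ge0.
  by rewrite subr_ge0; exact/lefP/nd_nnsfun_approx.
have sumd n x : (\sum_(0 <= i < n.+1) (dlt i x)%:E = (s n x)%:E)%E.
  elim: n => [|n IH]; first by rewrite big_nat1.
  by rewrite big_nat_recr//= IH -EFinD/= addrC subrK.
have hE : h = fun x => \sum_(0 <= n <oo) (dlt n x)%:E.
  apply/funext => x; apply/esym/cvg_lim => //; rewrite -(cvg_shiftS _).
  under eq_fun do rewrite /= sumd.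
  exact: cvg_nnsfun_approx.
have md n : nnmeas (fun x => (dlt n x)%:E).
  by split => [|x]; [exact/measurable_EFinP|rewrite lee_fin].
rewrite hE (sf_series sJ)// (sf_series sJ')//; apply: eq_eseriesr => n _.
exact: sf_ext_sfun.
Qed.

Lemma sigma_functional_probability J : sigma_functional J -> J (fun=> 1) = 1 ->
  exists Q : probability T R, forall h, nnmeas h -> \int[Q]_x h x = J h.
Proof.
move=> sJ J1.
(* The default 0 off the measurable sets keeps [m] total and nonnegative on every set. *)
pose m (A : set T) : \bar R := if pselect (measurable A) then J (fun x => (\1_A x)%:E) else 0.
have mE A : measurable A -> m A = J (fun x => (\1_A x)%:E).
  by move=> mA; rewrite /m; case: pselect.
have m0 : m set0 = 0.
  by rewrite mE// -[RHS](sf_cst0 sJ); congr J; apply/funext => x; rewrite indic0.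
have m_ge0 A : 0 <= m A.
  by rewrite /m; case: pselect => // mA; apply: (sf_ge0 sJ); exact: nnmeas_indic.
have m_sigma : semi_sigma_additive m.
  move=> F mF tF mUF; rewrite mE//.
  have -> : (fun x => (\1_(\bigcup_n F n) x)%:E : \bar R) =
      fun x => \sum_(0 <= n <oo) (\1_(F n) x)%:E.
    by apply/funext => x; rewrite -[RHS]indic_bigcup.
  rewrite (sf_series sJ)//; last by move=> n; exact: nnmeas_indic.
  under eq_fun do under eq_bigr do rewrite mE//.
  apply: is_cvg_nneseries => n _ _; apply: (sf_ge0 sJ); exact: nnmeas_indic.
pose mix := isMeasure.Build d T R m m0 m_ge0 m_sigma.
pose mm : {measure set T -> \bar R} := HB.pack m mix.
have mT : mm [set: T] = 1.
  by rewrite /= mE// -J1; congr J; apply/funext => x; rewrite indicT.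
pose pix := Measure_isProbability.Build d T R mm mT.
pose Q : probability T R := HB.pack m mix pix.
exists Q => h mh; apply: (sf_ext (sigma_functional_integral Q) sJ) => // A mA.
by rewrite integral_indic// setIT -mE.
Qed.

End sigma_functional.

(** * Lévy's uniqueness theorem *)

Section levy_uniqueness.
Context (R : realType).
Notation leb := (@lebesgue_measure R).

Lemma is_derive_compZ (f : R -> R) (a u df : R) :
  is_derive (u * a) (1 : R) f df -> is_derive u (1 : R) (fun v : R => f (v * a)) (a * df).
Proof.
move=> Hf.
have H : is_derive u (1 : R) (fun v : R => v * a) a.
  have -> : (fun v : R => v * a) = a \*: (id : R -> R).
    by apply/funext => v; rewrite /= mulrC.
  by apply: is_derive_eq; rewrite /GRing.scale /= mulr1.
have := @is_derive1_comp R f (fun v => v * a) u df a Hf H.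
by rewrite mulrC.
Qed.

Lemma is_derive_continuous (f df : R -> R) :
  (forall x : R, is_derive x (1 : R) f (df x)) -> continuous f.
Proof.
move=> H x; apply: differentiable_continuous; apply/derivable1_diffP.
exact: (@ex_derive _ _ _ _ _ _ _ (H x)).
Qed.

(** Antiderivative in u of exp(- e u) (1 + cos(u z)); the second term is the real part of exp(u (- e
    + i z)) / (- e + i z). *)
Let F (e z u : R) := - (expR (u * - e) / e) +
  expR (u * - e) * ((z * sin (u * z) - e * cos (u * z)) / (e ^+ 2 + z ^+ 2)).

(* The summand 1 keeps the integrand nonnegative, so that only Tonelli is needed below. *)
Lemma integral_exp_cos (e z : R) : 0 < e ->
  (\int[leb]_(u in `[0%R, +oo[) (expR (u * - e) * (1 + cos (u * z)))%:E
   = (e^-1 + e / (e ^+ 2 + z ^+ 2))%:E)%E.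
Proof.
move=> e0.
have dn0 : e ^+ 2 + z ^+ 2 != 0.
  by apply: lt0r_neq0; rewrite ltr_wpDr ?sqr_ge0// exprn_gt0.
have dF (u : R) : is_derive u (1 : R) (F e z) (expR (u * - e) * (1 + cos (u * z))).
  have d1 := is_derive_compZ (is_derive_expR (u * - e)).
  have d2 := is_derive_compZ (is_derive_sin (u * z)).
  have d3 := is_derive_compZ (is_derive_cos (u * z)).
  have -> : F e z = (- e^-1) \*: (fun v => expR (v * - e)) +
    (e ^+ 2 + z ^+ 2)^-1 \*: ((fun v => expR (v * - e)) *
      (z \*: (fun v => sin (v * z)) + (- e) \*: (fun v => cos (v * z)))).
    apply/funext => v; rewrite /F !fctE /= /GRing.scale /=.
    by field; rewrite dn0 gt_eqF.
  apply: is_derive_eq; rewrite !fctE /GRing.scale /= /GRing.scale /=.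
  by field; rewrite dn0 gt_eqF.
have cf : continuous (fun u : R => expR (u * - e) * (1 + cos (u * z))).
  move=> u; apply: cvgM; first by apply: continuous_comp; [exact: mulrr_continuous|exact: continuous_expR].
  apply: cvgD; first exact: cvg_cst.
  by apply: continuous_comp; [exact: mulrr_continuous|exact: continuous_cos].
have cF := is_derive_continuous dF.
rewrite (@ge0_continuous_FTC2y _ _ (F e z) _ 0).
- rewrite -EFinB /F !mul0r expR0 cos0 sin0; congr EFin; field.
  by rewrite dn0 gt_eqF.
- move=> u _; rewrite mulr_ge0 ?expR_ge0//; have := cos_geN1 (u * z); lra.
- exact: continuous_subspaceT.
(* [F] is exp(- e u) times a factor bounded by [K], so its limit at infinity is 0. *)
- pose K := e^-1 + (`|z| + e) / (e ^+ 2 + z ^+ 2).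
  have cE : expR (u * - e) @[u --> +oo%R] --> (0 : R).
    rewrite (_ : (fun u => expR (u * - e)) = (fun z => expR (- z)) \o (fun u => e * u)); last first.
      by apply: eq_fun => x; rewrite mulrN mulrC.
    apply: (@cvg_comp _ _ _ _ _ _ (pinfty_nbhs R)); last exact: cvgr_expR.
    exact: gt0_cvgMry.
  have cK : K * expR (u * - e) @[u --> +oo%R] --> (0 : R).
    by rewrite -[X in _ --> X](mulr0 K); apply: cvgM => //; exact: cvg_cst.
  have cNK : - (K * expR (u * - e)) @[u --> +oo%R] --> (0 : R).
    by rewrite -[X in _ --> X]oppr0; exact: cvgN.
  apply: (squeeze_cvgr _ cNK cK); near=> u; rewrite -ler_norml.
  have -> : F e z u = expR (u * - e) *
      ((z * sin (u * z) - e * cos (u * z)) / (e ^+ 2 + z ^+ 2) - e^-1).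
    by rewrite /F; ring.
  rewrite normrM (ger0_norm (expR_ge0 _)) mulrC ler_wpM2r ?expR_ge0//.
  rewrite (le_trans (ler_normB _ _))// addrC /K lerD//.
    by rewrite ger0_norm// invr_ge0 ltW.
  rewrite normrM normfV (ger0_norm (addr_ge0 (sqr_ge0 _) (sqr_ge0 _))).
  rewrite ler_wpM2r ?invr_ge0 ?addr_ge0 ?sqr_ge0// (le_trans (ler_normB _ _))//.
  rewrite !normrM (gtr0_norm e0) lerD//.
    by rewrite ler_piMr// ler_norml sin_geN1 sin_le1.
  by rewrite ler_piMr ?(ltW e0)// ler_norml cos_geN1 cos_le1.
- by move=> u _; exact: (@ex_derive _ _ _ _ _ _ _ (dF u)).
- exact/cvg_at_right_filter/cF.
- by move=> u _; rewrite derive1E; exact: (@derive_val _ _ _ _ _ _ _ (dF u)).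
Unshelve. all: by end_near. Qed.

(** The term [(b - a) / e] is the trace of the summand 1 in [integral_exp_cos]; the arctangent
    difference is, up to the factor pi, a smoothed indicator of [a, b]. *)
Lemma integral_cauchy_kernel (e a b x : R) : 0 < e -> a < b ->
  (\int[leb]_(y in `[a, b]) (e^-1 + e / (e ^+ 2 + (y - x) ^+ 2))%:E
   = ((b - a) / e + (atan ((b - x) / e) - atan ((a - x) / e)))%:E)%E.
Proof.
move=> e0 ab.
have dn0 y : e ^+ 2 + (y - x) ^+ 2 != 0.
  by apply: lt0r_neq0; rewrite ltr_wpDr ?sqr_ge0// exprn_gt0.
pose G (y : R) := y * e^-1 + atan ((y - x) / e).
have dG (y : R) : is_derive y (1 : R) G (e^-1 + e / (e ^+ 2 + (y - x) ^+ 2)).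
  have dl : is_derive y (1 : R) (fun v : R => (v - x) / e) e^-1.
    have -> : (fun v : R => (v - x) / e) = e^-1 \*: ((id : R -> R) + cst (- x)).
      by apply/funext => v; rewrite !fctE /= mulrC.
    by apply: is_derive_eq; rewrite subr0 /GRing.scale /= mulr1.
  have da : is_derive ((y - x) / e) 1 (@atan R) (1 + ((y - x) / e) ^+ 2)^-1.
    exact: is_derive1_atan.
  have dc := @is_derive1_comp R atan (fun v : R => (v - x) / e) _ _ _ da dl.
  have -> : G = e^-1 \*: (id : R -> R) + (atan \o (fun v : R => (v - x) / e)).
    by apply/funext => v; rewrite /G !fctE /= /GRing.scale /= mulrC.
  apply: is_derive_eq; rewrite /GRing.scale /= mulr1; congr (_ + _).
  have : 1 + ((y - x) / e) ^+ 2 != 0.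
    by apply: lt0r_neq0; rewrite ltr_wpDr ?sqr_ge0.
  by move=> h; field; rewrite dn0 gt_eqF.
have cG := is_derive_continuous dG.
rewrite (@continuous_FTC2 _ _ G)//.
- by rewrite -EFinB /G; congr EFin; rewrite -!/(_ / _); field; rewrite gt_eqF.
- apply: continuous_subspaceT => y; apply: cvgD; first exact: cvg_cst.
  apply: cvgM; first exact: cvg_cst.
  apply: cvgV; first exact: dn0.
  apply: cvgD; first exact: cvg_cst.
  apply: (@continuous_comp _ _ _ (fun y => y - x) (fun y => y ^+ 2)); last exact: exprn_continuous.
  by apply: cvgB; [exact: cvg_id|exact: cvg_cst].
- split => [y _||].
  + exact: (@ex_derive _ _ _ _ _ _ _ (dG y)).
  + exact/cvg_at_right_filter/cG.
  + exact/cvg_at_left_filter/cG.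
- by move=> y _; rewrite derive1E; exact: (@derive_val _ _ _ _ _ _ _ (dG y)).
Qed.

Lemma measurable_cos : measurable_fun setT (@cos R).
Proof. by apply: continuous_measurable_fun; exact: continuous_cos. Qed.

Lemma tonelli_restrict (P : probability R R) (D : set R) (f : R -> R -> R) :
  measurable D -> measurable_fun setT (fun p : R * R => f p.1 p.2) ->
  (forall x y, 0 <= f x y) ->
  (\int[P]_x \int[leb]_(y in D) (f x y)%:E = \int[leb]_(y in D) \int[P]_x (f x y)%:E)%E.
Proof.
move=> mD mf f0.
pose g (p : R * R) : \bar R := (f p.1 p.2 * \1_D p.2)%:E.
have mg : measurable_fun setT g.
  apply/measurable_EFinP/measurable_funM => //.
  by apply: measurableT_comp => //; exact: measurable_indic.
have g0 p : (0 <= g p)%E by rewrite lee_fin mulr_ge0.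
have := fubini_tonelli (m1 := P) (m2 := leb) g mg g0; rewrite /g /= => FT.
rewrite [RHS]integral_mkcond.
transitivity (\int[P]_x \int[leb]_y (f x y * \1_D y)%:E)%E.
  apply: eq_integral => x _; rewrite integral_mkcond; apply: eq_integral => y _.
  by rewrite patchE indicE; case: ifP; rewrite ?mulr1 ?mulr0.
rewrite FT; apply: eq_integral => y _; rewrite patchE; case: ifP => yD.
  by apply: eq_integral => x _; rewrite indicE yD mulr1.
by rewrite integral0_eq// => x _; rewrite indicE yD mulr0.
Qed.

(** The phase [t] lets one nonnegative family carry the whole characteristic function: t = 0 gives
    the cosine, t = pi / 2 the sine. *)
Definition osc (u t x : R) : \bar R := (1 + cos (u * x - t))%:E.

Lemma nnmeas_osc (u t : R) : nnmeas (osc u t).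
Proof.
split; last by move=> x; rewrite lee_fin; have := cos_geN1 (u * x - t); lra.
apply/measurable_EFinP/measurable_funD => //.
by apply: (measurableT_comp measurable_cos); apply: measurable_funB => //; exact: measurable_funM.
Qed.

(** The Cauchy kernel is a Laplace transform in u of cosines, so after Tonelli the right-hand side
    sees [P] only through integrals of [osc]; the phase [u * y] centres the kernel at y. *)
Lemma integral_atan_cosE (P : probability R R) (e a b : R) : 0 < e -> a < b ->
  (\int[P]_x ((b - a) / e + (atan ((b - x) / e) - atan ((a - x) / e)))%:E =
   \int[leb]_(y in `[a, b]) \int[leb]_(u in `[0%R, +oo[)
     ((expR (u * - e))%:E * \int[P]_x osc u (u * y) x))%E.
Proof.
move=> e0 ab.
pose D1 := [set` `[a, b]]; pose D2 := [set` `[(0 : R), +oo[].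
have mD1 : measurable D1 by exact: measurable_itv.
have mD2 : measurable D2 by exact: measurable_itv.
pose k (x y : R) : R := e^-1 + e / (e ^+ 2 + (y - x) ^+ 2).
have k0 x y : 0 <= k x y.
  by rewrite addr_ge0 ?invr_ge0 ?(ltW e0)// divr_ge0 ?(ltW e0)// addr_ge0 ?sqr_ge0.
have mk : measurable_fun setT (fun p : R * R => k p.1 p.2).
  apply: measurable_funD => //; apply: measurable_funM => //.
  apply: (@measurableT_comp _ _ _ _ _ _ (fun w : R => (e ^+ 2 + w ^+ 2)^-1)
            _ (fun p : R * R => p.2 - p.1)); last exact: measurable_funB.
  apply: continuous_measurable_fun => w; apply: cvgV.
    by apply: lt0r_neq0; rewrite ltr_wpDr ?sqr_ge0// exprn_gt0.
  by apply: cvgD; [exact: cvg_cst|exact: exprn_continuous].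
have mE : measurable_fun setT (fun u : R => expR (u * - e)).
  by apply: measurableT_comp => //; exact: measurable_funM.
have mo y : measurable_fun setT (fun p : R * R => 1 + cos (p.2 * p.1 - p.2 * y)).
  apply: measurable_funD => //; apply: (measurableT_comp measurable_cos).
  by apply: measurable_funB; apply: measurable_funM.
transitivity (\int[P]_x \int[leb]_(y in D1) (k x y)%:E)%E.
  by apply: eq_integral => x _; rewrite integral_cauchy_kernel.
transitivity (\int[leb]_(y in D1) \int[P]_x (k x y)%:E)%E.
  exact: tonelli_restrict.
apply: eq_integral => y _.
transitivity (\int[P]_x \int[leb]_(u in D2) ((expR (u * - e))%:E * osc u (u * y) x))%E.
  apply: eq_integral => x _; rewrite /k -integral_exp_cos//.
  apply: eq_integral => u _; rewrite /osc EFinM; do 3 congr (_ _).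
  by rewrite -[RHS]cosN; congr cos; ring.
rewrite (@tonelli_restrict P D2 (fun x u => expR (u * - e) * (1 + cos (u * x - u * y))))//.
- apply: eq_integral => u _; rewrite -ge0_integralZl_EFin//.
  + by move=> x _; exact: (nnmeas_osc _ _).2.
  + exact: (nnmeas_osc _ _).1.
- apply: measurable_funM => //.
  exact: (measurableT_comp mE).
Qed.

(* The shift by n + 1 breaks the tie at c = 0: endpoints go to the same side, and the
   smoothed indicators converge to that of a half-open interval ]a, b]. *)
Lemma cvg_atan_scaled_shift (c : R) :
  atan (c * n.+1%:R ^+ 2 + n.+1%:R) @[n --> \oo] -->
  (if 0 <= c then pi / 2 else - (pi / 2) : R).
Proof.
have atn : atan (n%:R : R) @[n --> \oo] --> (pi / 2 : R).
  exact: (@cvg_comp _ _ _ (fun n : nat => n%:R : R) (@atan R) _ _ _ cvgr_idn (@cvgy_atan R)).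
have atn1 : atan (n.+1%:R : R) @[n --> \oo] --> (pi / 2 : R).
  by move: atn; rewrite -(cvg_shiftS (fun n => atan (n%:R : R))).
have bnd x : - (pi / 2) <= atan x <= (pi / 2 : R).
  by rewrite (ltW (atan_gtNpi2 x)) (ltW (atan_ltpi2 x)).
case: ifPn => [c0|]; last rewrite -ltNge => c0.
  apply: (squeeze_cvgr _ atn1 (cvg_cst (pi / 2))); near=> n.
  by rewrite (andP (bnd _)).2 andbT le_atan// lerDr mulr_ge0// sqr_ge0.
have atnN : - atan (n.+1%:R : R) @[n --> \oo] --> - (pi / 2 : R) by exact: cvgN.
apply: (squeeze_cvgr _ (cvg_cst (- (pi / 2))) atnN); near=> n.
rewrite (andP (bnd _)).1 /= -atanN le_atan//.
(* With N = n + 1 this gives c N <= - 2, hence c N^2 + N <= - N. *)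
have : 2 <= n%:R * - c.
  rewrite -ler_pdivrMr ?oppr_gt0//; near: n.
  exact: nbhs_infty_ger.
have : (0 : R) <= n%:R by [].
rewrite -natr1; nra.
Unshelve. all: by end_near. Qed.

(** The term [(b - a) / e] is finite and, both measures having mass 1, contributes equally to both
    integrals, so it cancels. *)
Lemma eq_integral_atan (P Q : probability R R) (e a b : R) : 0 < e -> a < b ->
  (forall u t : R, \int[P]_x osc u t x = \int[Q]_x osc u t x)%E ->
  (\int[P]_x (atan ((b - x) / e) - atan ((a - x) / e))%:E =
   \int[Q]_x (atan ((b - x) / e) - atan ((a - x) / e))%:E)%E.
Proof.
move=> e0 ab PQ.
pose h (x : R) : \bar R := (atan ((b - x) / e) - atan ((a - x) / e))%:E.
have mat : measurable_fun setT (@atan R).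
  by apply: continuous_measurable_fun; exact: continuous_atan.
have nh : nnmeas h.
  split; last first.
    move=> x; rewrite lee_fin subr_ge0 le_atan// ler_pM2r ?invr_gt0//.
    by rewrite lerD2r ltW.
  apply/measurable_EFinP/measurable_funB;
    by apply: (measurableT_comp mat); apply: measurable_funM => //; apply: measurable_funB.
have K (P' : probability R R) :
    (\int[P']_x ((b - a) / e + (atan ((b - x) / e) - atan ((a - x) / e)))%:E
     = ((b - a) / e)%:E + \int[P']_x h x)%E.
  under eq_integral do rewrite EFinD.
  rewrite ge0_integralD//=.
  - by rewrite integral_cst// [X in (_ * X + _)%E](@probability_setT _ _ _ P') mule1.
  - by move=> x _; rewrite lee_fin divr_ge0 ?(ltW e0)// subr_ge0 ltW.
  - by move=> x _; exact: nh.2.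
  - exact: nh.1.
have /eqP : (((b - a) / e)%:E + \int[P]_x h x = ((b - a) / e)%:E + \int[Q]_x h x)%E.
  have KP := K P; have KQ := K Q.
  rewrite (integral_atan_cosE P e0 ab) in KP; rewrite (integral_atan_cosE Q e0 ab) in KQ.
  rewrite -KP -KQ.
  by apply: eq_integral => y _; apply: eq_integral => u _; rewrite PQ.
by rewrite eq_le !leeD2lE// -eq_le => /eqP.
Qed.

Lemma probability_eq_itv (P Q : probability R R) (a b : R) : a < b ->
  (forall u t : R, \int[P]_x osc u t x = \int[Q]_x osc u t x)%E ->
  P `]a, b]%classic = Q `]a, b]%classic.
Proof.
move=> ab PQ.
(* The smoothing width is of smaller order than the shift 1 / (n + 1): at an endpoint the shift
   wins, while at a fixed distance from it the shift becomes negligible. *)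
pose e (n : nat) : R := (n.+1%:R ^+ 2)^-1.
have e0 n : 0 < e n by rewrite invr_gt0 exprn_gt0.
pose f (n : nat) (x : R) : \bar R :=
  (atan ((b + n.+1%:R^-1 - x) / e n) - atan ((a + n.+1%:R^-1 - x) / e n))%:E.
have fE c x n : (c + n.+1%:R^-1 - x) / e n = (c - x) * n.+1%:R ^+ 2 + n.+1%:R.
  by by rewrite /e invrK; field.
have pi0 := pi_gt0 R.
have lim (P' : probability R R) :
    (\int[P']_x f n x)%E @[n --> \oo] --> (pi%:E * P' `]a, b]%classic)%E.
  have mI : measurable `]a, b]%classic by exact: measurable_itv.
  have -> : (pi%:E * P' `]a, b]%classic = \int[P']_x (pi * \1_`]a, b]%classic x)%:E)%E.
    under eq_integral do rewrite EFinM.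
    rewrite ge0_integralZl_EFin//= ?(ltW pi0)//.
    + by rewrite integral_indic// setIT.
    + exact/measurable_EFinP/measurable_indic.
  have mat : measurable_fun setT (@atan R).
    by apply: continuous_measurable_fun; exact: continuous_atan.
  apply: (@dominated_cvg _ _ _ _ setT measurableT f _ (cst pi%:E)) => //.
  - move=> n; apply/measurable_EFinP/measurable_funB;
      by apply: (measurableT_comp mat); apply: measurable_funM => //; apply: measurable_funB.
  - move=> x _; rewrite /f; apply: cvg_EFin; first exact: nearW.
    rewrite [X in X @ _ --> _](_ : _ = fun n => atan ((b - x) * n.+1%:R ^+ 2 + n.+1%:R) - atan ((a - x) * n.+1%:R ^+ 2 + n.+1%:R)); last first.
      by apply/funext => n /=; rewrite !fE.
    pose g (c : R) : R := if 0 <= c then pi / 2 else - (pi / 2).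
    have gE : g (b - x) - g (a - x) = pi * \1_`]a, b]%classic x.
      rewrite /g indicE; case: ifPn; rewrite ?subr_ge0 => xb; case: ifPn; rewrite ?subr_ge0 => xa.
      + rewrite memNset ?mulr0 ?subrr//= in_itv/=; apply/negP; rewrite negb_and -leNgt xa//.
      + rewrite mem_set ?mulr1/= ?in_itv/= ?xb ?andbT ?ltNge//; lra.
      + by move: (le_trans xa (ltW ab)); rewrite (negbTE xb).
      + rewrite memNset ?mulr0 ?subrr//= in_itv/= (negbTE xb) andbF//.
    rewrite -gE.
    by apply: cvgB; exact: cvg_atan_scaled_shift.
  - exact: finite_measure_integrable_cst.
  - move=> n x _; rewrite /f /= lee_fin.
    have := atan_gtNpi2 ((b + n.+1%:R^-1 - x) / e n); have := atan_ltpi2 ((b + n.+1%:R^-1 - x) / e n).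
    have := atan_gtNpi2 ((a + n.+1%:R^-1 - x) / e n); have := atan_ltpi2 ((a + n.+1%:R^-1 - x) / e n).
    rewrite ler_norml; lra.
have : (pi%:E * P `]a, b]%classic = pi%:E * Q `]a, b]%classic)%E.
  have PQf : (fun n => \int[P]_x f n x)%E = (fun n => \int[Q]_x f n x)%E.
    by apply/funext => n; apply: eq_integral_atan => //; rewrite ltrD2r.
  have := lim Q; rewrite -PQf => limQ.
  by apply: (cvg_unique _ (lim P) limQ).
move=> H; have : (pi^-1%:E * (pi%:E * P `]a, b]%classic) = pi^-1%:E * (pi%:E * Q `]a, b]%classic))%E by rewrite H.
by rewrite !muleA -!EFinM mulVf ?gt_eqF// !mul1e.
Qed.

Lemma probability_eq_osc (P Q : probability R R) :
  (forall u t : R, \int[P]_x osc u t x = \int[Q]_x osc u t x)%E ->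
  forall A, measurable A -> P A = Q A.
Proof.
move=> PQ A mA.
apply: (@measure_unique _ R _ (@ocitv R) (fun n => `]- n.+1%:R, n.+1%:R]%classic) _ _ _ _ P Q) => //.
- exact: ocitvI.
- by move=> n; exact: is_ocitv.
- rewrite -subTset => x _ /=.
  exists (Num.truncn `|x|) => //=; rewrite in_itv/=.
  have := truncnS_gt `|x|; rewrite ltr_norml => /andP[-> /ltW->]//.
- move=> _ /ocitvP[->|[[a b] /= ab ->]]; first by rewrite !measure0.
  exact: probability_eq_itv.
- by move=> n; rewrite (le_lt_trans (probability_le1 _ _)) ?ltry//.
Qed.

End levy_uniqueness.

(** * Compound Poisson laws *)

Section complex_exponential.
Context (R : realType) (c s : R).

(* Real and imaginary parts of (c + i s)^k. *)
Fixpoint cpow (k : nat) : R * R :=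
  if k is k'.+1 then
    ((cpow k').1 * c - (cpow k').2 * s, (cpow k').1 * s + (cpow k').2 * c)
  else (1, 0).

Lemma cpow_bound k :
  `|(cpow k).1| <= (`|c| + `|s|) ^+ k /\ `|(cpow k).2| <= (`|c| + `|s|) ^+ k.
Proof.
elim: k => [|k [IH1 IH2]] /=; first by rewrite normr1 normr0 expr0.
split.
  rewrite (le_trans (ler_normB _ _))// !normrM exprSr mulrDr lerD//;
    exact: ler_wpM2r.
rewrite (le_trans (ler_normD _ _))// !normrM exprSr mulrDr addrC lerD//;
  exact: ler_wpM2r.
Qed.

(** Coefficients of a Re + b Im of the series of exp(x (c + i s)). Keeping both [a] and [b] makes
    the family closed under differentiation, which acts linearly on the pair (a, b). *)
Let L (a b : R) (k : nat) : R := (a * (cpow k).1 + b * (cpow k).2) / k`!%:R.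

Let is_cvg_L a b x : cvgn (pseries (L a b) x).
Proof.
apply: normed_cvg.
pose r := `|c| + `|s|.
apply: (@series_le_cvg _ _ (fun k => (`|a| + `|b|) * exp_coeff (r * `|x|) k)).
- by move=> k; exact: normr_ge0.
- by move=> k; rewrite mulr_ge0 ?addr_ge0// exp_coeff_ge0// mulr_ge0// addr_ge0.
- move=> k; have [h1 h2] := cpow_bound k.
  rewrite /L /exp_coeff /= !normrM normfV normr_nat normrX exprMn mulrAC !mulrA.
  rewrite ler_wpM2r ?invr_ge0// ler_wpM2r ?exprn_ge0//.
  rewrite (le_trans (ler_normD _ _))// !normrM mulrDl lerD//; exact: ler_wpM2l.
- by apply: is_cvg_seriesZ; exact: is_cvg_series_exp_coeff.
Qed.

Let F a b x : R := limn (pseries (L a b) x).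

Let F_linear a b x : F a b x = a * F 1 0 x + b * F 0 1 x.
Proof.
apply/cvg_lim => //.
have -> : pseries (L a b) x = a \*: pseries (L 1 0) x + b \*: pseries (L 0 1) x.
  apply/funext => n; rewrite !fctE /pseries /series /= /GRing.scale /= !mulr_sumr -big_split /=.
  by apply: eq_bigr => k _; rewrite /L; ring.
by apply: cvgD; apply: cvgZr; exact: is_cvg_L.
Qed.

Let L_diffs a b : pseries_diffs (L a b) = L (a * c + b * s) (b * c - a * s).
Proof.
apply/funext => k; rewrite /pseries_diffs /L factS natrM /= invfM.
rewrite mulrCA !mulrA; congr (_ / _).
by rewrite mulfK ?pnatr_eq0//; ring.
Qed.

Let dF a b (x : R) : is_derive x (1 : R) (F a b) (F (a * c + b * s) (b * c - a * s) x).
Proof.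
have xK : `|x| < `| `|x| + 1| by rewrite [ltRHS]ger0_norm ?addr_ge0// ltrDl.
by have := @pseries_snd_diffs _ (L a b) (`|x| + 1) x; rewrite !L_diffs; apply.
Qed.

Let F0 a b : F a b 0 = a.
Proof.
apply/cvg_lim => //; rewrite -(cvg_shiftS _).
apply: cvg_near_cst; apply: nearW => n.
rewrite /pseries /series /= big_nat_recl//= big1_seq ?addr0; last first.
  by move=> k _; rewrite expr0n /= mulr0.
by rewrite /L /= mulr1 mulr0 addr0 expr0 mulr1 fact0 divr1.
Qed.

Let E (x : R) : R := expR (x * - c).

(* exp(- x (c + i s)) times the power series of exp(x (c + i s)) has derivative 0. *)
Let rotation (x : R) :
  E x * (F 1 0 x * cos (x * s) + F 0 1 x * sin (x * s)) = 1 /\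
  E x * (F 0 1 x * cos (x * s) - F 1 0 x * sin (x * s)) = 0.
Proof.
have dE (y : R) : is_derive y (1 : R) E (- c * E y) by exact: is_derive_compZ.
have dC (y : R) := is_derive_compZ (is_derive_cos (y * s)).
have dS (y : R) := is_derive_compZ (is_derive_sin (y * s)).
pose G1 : R -> R := E * (F 1 0 * (fun x => cos (x * s)) + F 0 1 * (fun x => sin (x * s))).
pose G2 : R -> R := E * (F 0 1 * (fun x => cos (x * s)) - F 1 0 * (fun x => sin (x * s))).
have d10 (y : R) : is_derive y (1 : R) (F 1 0) (c * F 1 0 y - s * F 0 1 y).
  by apply: (is_derive_eq (dF 1 0 y)); rewrite (F_linear (1 * c + 0 * s)); ring.
have d01 (y : R) : is_derive y (1 : R) (F 0 1) (s * F 1 0 y + c * F 0 1 y).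
  by apply: (is_derive_eq (dF 0 1 y)); rewrite (F_linear (0 * c + 1 * s)); ring.
have H1 (y : R) : is_derive y (1 : R) G1 0.
  have hC := dC y; have hS := dS y; have hE := dE y; have h10 := d10 y; have h01 := d01 y.
  rewrite /G1; apply: is_derive_eq; rewrite !fctE /GRing.scale /= /GRing.scale /=; ring.
have H2 (y : R) : is_derive y (1 : R) G2 0.
  have hC := dC y; have hS := dS y; have hE := dE y; have h10 := d10 y; have h01 := d01 y.
  rewrite /G2; apply: is_derive_eq; rewrite !fctE /GRing.scale /= /GRing.scale /=; ring.
have := is_derive_0_is_cst x 0 H1; have := is_derive_0_is_cst x 0 H2.
rewrite /G1 /G2 !fctE /= !F0 /E !mul0r expR0 cos0 sin0 => -> ->.
by split; ring.
Qed.

(** The two identities of [rotation] form a linear system for the two series, with a rotation matrix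
    that is inverted by cos^2 + sin^2 = 1. *)
Let FE (x : R) : F 1 0 x = expR (x * c) * cos (x * s) /\
  F 0 1 x = expR (x * c) * sin (x * s).
Proof.
have [] := rotation x.
set C := cos _; set S := sin _; set f := F 1 0 x; set g := F 0 1 x.
have EE : expR (x * c) * E x = 1 by rewrite /E -expRD mulrN subrr expR0.
have CS : C ^+ 2 + S ^+ 2 = 1 by rewrite cos2Dsin2.
move=> h1 h2; split.
  transitivity ((expR (x * c) * E x) * (C ^+ 2 + S ^+ 2) * f); first by rewrite EE CS !mul1r.
  transitivity (expR (x * c) * ((E x * (f * C + g * S)) * C - (E x * (g * C - f * S)) * S)); first by ring.
  by rewrite h1 h2 mul1r mul0r subr0.
transitivity ((expR (x * c) * E x) * (C ^+ 2 + S ^+ 2) * g); first by rewrite EE CS !mul1r.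
transitivity (expR (x * c) * ((E x * (f * C + g * S)) * S + (E x * (g * C - f * S)) * C)); first by ring.
by rewrite h1 h2 mul1r mul0r addr0.
Qed.

Lemma cvg_series_cpow (a b x : R) :
  series (fun k => x ^+ k / k`!%:R * (a * (cpow k).1 + b * (cpow k).2)) @ \oo -->
  expR (x * c) * (a * cos (x * s) + b * sin (x * s)).
Proof.
have [F1 F2] := FE x.
have -> : expR (x * c) * (a * cos (x * s) + b * sin (x * s)) = F a b x.
  by rewrite F_linear F1 F2; ring.
have -> : (fun k => x ^+ k / k`!%:R * (a * (cpow k).1 + b * (cpow k).2)) =
    (fun k => L a b k * x ^+ k).
  by apply/funext => k; rewrite /L; ring.
exact: is_cvg_L.
Qed.

End complex_exponential.

(** * Composition, scaling and series of integration functionals *)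

Section functional_operations.
Context d (T : measurableType d) (R : realType).
Local Open Scope ereal_scope.

Lemma sigma_functional_comp (J : (T -> \bar R) -> \bar R)
    (K : (T -> \bar R) -> T -> \bar R) :
  (forall h, nnmeas h -> nnmeas (K h)) ->
  (forall x, sigma_functional (fun h => K h x)) ->
  sigma_functional J -> sigma_functional (fun h => J (K h)).
Proof.
move=> mK sK sJ; split.
- by move=> h mh; apply: (sf_ge0 sJ); exact: mK.
- move=> c h c0 mh; rewrite -(sf_scale sJ c0 (mK _ mh)).
  by congr J; apply/funext => x; rewrite (sf_scale (sK x)).
- move=> f g mf mg; rewrite -(sf_add sJ (mK _ mf) (mK _ mg)).
  by congr J; apply/funext => x; rewrite (sf_add (sK x)).
- move=> h mh; rewrite -(sf_series sJ)//; last by move=> n; exact: mK.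
  by congr J; apply/funext => x; rewrite (sf_series (sK x)).
Qed.

Lemma sigma_functional_scale (J : (T -> \bar R) -> \bar R) (w : R) :
  (0 <= w)%R -> sigma_functional J -> sigma_functional (fun h => w%:E * J h).
Proof.
move=> w0 sJ; split.
- by move=> h mh; rewrite mule_ge0// (sf_ge0 sJ).
- by move=> c h c0 mh; rewrite (sf_scale sJ)// muleCA.
- by move=> f g mf mg; rewrite (sf_add sJ)// ge0_muleDr// (sf_ge0 sJ).
- move=> h mh; rewrite (sf_series sJ)// nneseriesZl// => n _.
  exact: (sf_ge0 sJ).
Qed.

Lemma sigma_functional_series (J : nat -> (T -> \bar R) -> \bar R) :
  (forall k, sigma_functional (J k)) ->
  sigma_functional (fun h => \sum_(0 <= k <oo) J k h).
Proof.
move=> sJ; split.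
- by move=> h mh; apply: nneseries_ge0 => k _ _; exact: (sf_ge0 (sJ k)).
- move=> c h c0 mh; rewrite -nneseriesZl; last by move=> k _; exact: (sf_ge0 (sJ k)).
  by apply: eq_eseriesr => k _; rewrite (sf_scale (sJ k)).
- move=> f g mf mg; rewrite -nneseriesD;
    [|by move=> k _ _; exact: (sf_ge0 (sJ k))..].
  by apply: eq_eseriesr => k _; rewrite (sf_add (sJ k)).
- move=> h mh; rewrite nneseries_interchange; last first.
    by move=> k n; exact: (sf_ge0 (sJ n)).
  by apply: eq_eseriesr => k _; rewrite (sf_series (sJ k)).
Qed.

End functional_operations.

(** * The compound Poisson law and its characteristic function *)

Section compound_poisson.
Context (R : realType).
Notation leb := (@lebesgue_measure R).
Implicit Types (N : R -> R) (h : R -> \bar R).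

Definition jump N h (x : R) : \bar R := (\int[leb]_y (h (x + y)%R * (N y)%:E))%E.

Definition mass N : R := Rintegral leb setT N.

(* E[h(X_D)] for the compound Poisson process X with Lévy density N: [iter k (jump N) h 0]
   is the integral of h against the k-fold convolution power of N(y) dy. *)
Definition cpoisson (D : R) N h : \bar R :=
  ((expR (- (D * mass N)))%:E *
   \sum_(0 <= k <oo) ((D ^+ k / k`!%:R)%:E * iter k (jump N) h 0%R))%E.

Definition finite_density N : Prop :=
  [/\ measurable_fun setT N, forall x, 0 <= N x & leb.-integrable setT (EFin \o N)].

Section fixed_density.
Variable N : R -> R.
Hypothesis fN : finite_density N.

Lemma nnmeas_density : nnmeas (EFin \o N).
Proof. by case: fN => mN N0 _; split => [|x]; [exact/measurable_EFinP|rewrite lee_fin]. Qed.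

Lemma nnmeas_translate h x : nnmeas h -> nnmeas (fun y : R => h (x + y)%R).
Proof.
move=> [mh h0]; split; last by move=> y; exact: h0.
by apply: (measurableT_comp mh); exact: measurable_funD.
Qed.

Lemma nnmeas_jump h : nnmeas h -> nnmeas (jump N h).
Proof.
move=> [mh h0]; have [mN N0] := nnmeas_density.
split; last by move=> x; apply: integral_ge0 => y _; rewrite mule_ge0// N0.
apply: (@measurable_fun_fubini_tonelli_F _ _ _ _ _ leb (fun p : R * R => (h (p.1 + p.2)%R * (N p.2)%:E)%E)).
  apply: emeasurable_funM.
    by apply: (measurableT_comp mh); exact: measurable_funD.
  by apply: (measurableT_comp mN).
by move=> p; rewrite mule_ge0// N0.
Qed.

Lemma sigma_functional_jump x : sigma_functional (fun h => jump N h x).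
Proof.
pose K h (y : R) := (h (x + y)%R * (N y)%:E)%E.
(* [sigma_functional_integral] does not unify here: [lebesgue_measure] lives on the alias
   [measurableTypeR R] of [R]. *)
have sL : sigma_functional (fun h : R -> \bar R => \int[leb]_y h y)%E.
  split.
  - by move=> h [_ h0]; exact: integral_ge0.
  - by move=> a h a0 [mh h0]; rewrite ge0_integralZl_EFin.
  - by move=> f g [mf f0] [mg g0]; rewrite ge0_integralD.
  - by move=> h mh; rewrite integral_nneseries// => n; [exact: (mh n).1|move=> y _; exact: (mh n).2].

apply: (sigma_functional_comp (K := K) _ _ sL).
  by move=> h mh; apply: nnmeas_mul; [exact: nnmeas_translate|exact: nnmeas_density].
move=> y; have Ny : (0 <= (N y)%:E)%E by exact: (nnmeas_density).2.
split.
- by move=> h mh; rewrite mule_ge0// mh.2.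
- by move=> c h c0 mh; rewrite /K muleA.
- by move=> f g mf mg; rewrite /K ge0_muleDl ?mf.2 ?mg.2.
- move=> h mh; rewrite /K muleC -nneseriesZl; last by move=> n _; exact: (mh n).2.
  by apply: eq_eseriesr => n _; rewrite muleC.
Qed.

Lemma nnmeas_iter_jump k h : nnmeas h -> nnmeas (iter k (jump N) h).
Proof. by move=> mh; elim: k => //= k IH; exact: nnmeas_jump. Qed.

Lemma sigma_functional_iter_jump k x : sigma_functional (fun h => iter k (jump N) h x).
Proof.
elim: k x => [|k IH] x /=; first by split => // h mh; exact: mh.2.
apply: (@sigma_functional_comp _ _ _ (fun h => jump N h x) (fun h => iter k (jump N) h)) => //.
- exact: nnmeas_iter_jump.
- exact: sigma_functional_jump.
Qed.

Lemma sigma_functional_cpoisson D : 0 <= D -> sigma_functional (cpoisson D N).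
Proof.
move=> D0; apply: sigma_functional_scale; first exact: expR_ge0.
apply: sigma_functional_series => k; apply: sigma_functional_scale.
  by rewrite divr_ge0// exprn_ge0.
exact: sigma_functional_iter_jump.
Qed.

Lemma integrable_bounded_density (f : R -> R) : measurable_fun setT f ->
  (forall x, `|f x| <= 1) -> leb.-integrable setT (EFin \o (fun x => f x * N x)).
Proof.
move=> mf f1; case: fN => mN N0 iN.
apply: (le_integrable measurableT _ _ iN).
  exact/measurable_EFinP/measurable_funM.
move=> x _ /=; rewrite lee_fin normrM (ger0_norm (N0 x)).
by rewrite ler_piMl.
Qed.

Let c u : R := Rintegral leb setT (fun y => cos (u * y) * N y).
Let s u : R := Rintegral leb setT (fun y => sin (u * y) * N y).

Lemma measurable_sin : measurable_fun setT (@sin R).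
Proof. by apply: continuous_measurable_fun; exact: continuous_sin. Qed.

Let integrable_c u : leb.-integrable setT (EFin \o (fun y => cos (u * y) * N y)).
Proof.
apply: integrable_bounded_density; last first.
  by move=> x; rewrite ler_norml cos_geN1 cos_le1.
by apply: (measurableT_comp (@measurable_cos R)); exact: measurable_funM.
Qed.

Let integrable_s u : leb.-integrable setT (EFin \o (fun y => sin (u * y) * N y)).
Proof.
apply: integrable_bounded_density; last first.
  by move=> x; rewrite ler_norml sin_geN1 sin_le1.
by apply: (measurableT_comp measurable_sin); exact: measurable_funM.
Qed.

Lemma integral_trig u (A B C : R) :
  (\int[leb]_y ((A + B * cos (u * y) + C * sin (u * y)) * N y)%:E =
   (A * mass N + B * c u + C * s u)%:E)%E.
Proof.
case: (fN) => mN N0 iN.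
have iE (f : R -> R) : leb.-integrable setT (EFin \o f) ->
    (\int[leb]_y (f y)%:E = (Rintegral leb setT f)%:E)%E.
  by move=> fi; rewrite /Rintegral fineK//; exact: (integrable_fin_num measurableT fi).
have iZ (a : R) (f : R -> R) : leb.-integrable setT (EFin \o f) ->
    leb.-integrable setT (EFin \o (fun x => a * f x)).
  by move=> fi; have := integrableZl measurableT a fi.
have iD (f g : R -> R) : leb.-integrable setT (EFin \o f) -> leb.-integrable setT (EFin \o g) ->
    leb.-integrable setT (EFin \o (fun x => f x + g x)).
  by move=> fi gi; have := integrableD measurableT fi gi.
have I1 := iZ A _ iN; have I2 := iZ B _ (integrable_c u); have I3 := iZ C _ (integrable_s u).
have I12 := iD _ _ I1 I2; have I123 := iD _ _ I12 I3.
transitivity (\int[leb]_y (A * N y + B * (cos (u * y) * N y) + C * (sin (u * y) * N y))%:E)%E.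
  by apply: eq_integral => y _; congr EFin; ring.
by rewrite (iE _ I123) RintegralD// RintegralD// !RintegralZl.
Qed.

(** Constants are eigenfunctions of [jump N] with eigenvalue [mass N], and cos(u x - t), sin(u x -
    t) span an invariant plane on which it acts as multiplication by the complex number c(u) + i
    s(u). *)
Lemma iter_jump_osc u t k x : iter k (jump N) (osc u t) x =
  (mass N ^+ k + (cpow (c u) (s u) k).1 * cos (u * x - t)
               - (cpow (c u) (s u) k).2 * sin (u * x - t))%:E.
Proof.
elim: k x => [|k IH] x /=; first by rewrite mul1r mul0r subr0 expr0.
rewrite {1}/jump.
set p := cpow _ _ k.
transitivity (\int[leb]_y (((mass N ^+ k) +
   (p.1 * cos (u * x - t) - p.2 * sin (u * x - t)) * cos (u * y) +
   (- (p.1 * sin (u * x - t) + p.2 * cos (u * x - t))) * sin (u * y)) * N y)%:E)%E.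
  apply: eq_integral => y _; rewrite IH -EFinM -/p; congr EFin.
  have -> : u * (x + y) - t = (u * x - t) + u * y by ring.
  by rewrite (cosD (u * x - t)) (sinD (u * x - t)); ring.
by rewrite integral_trig exprSr; congr EFin; ring.
Qed.

(** The value is 1 + Re(exp(- i t) psi(u)), where psi is the compound Poisson characteristic
    function; expanding cos(D s(u) - t) gives the form shown. *)
Lemma cpoisson_osc D u t : cpoisson D N (osc u t) =
  (1 + expR (D * (c u - mass N)) * (cos t * cos (D * s u) + sin t * sin (D * s u)))%:E.
Proof.
pose v k := D ^+ k / k`!%:R * (mass N ^+ k + (cos t * (cpow (c u) (s u) k).1 + sin t * (cpow (c u) (s u) k).2)).
have cv : series v @ \oo --> expR (D * mass N) + expR (D * c u) * (cos t * cos (D * s u) + sin t * sin (D * s u)).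
  have -> : series v = series (exp_coeff (D * mass N)) + series (fun k => D ^+ k / k`!%:R * (cos t * (cpow (c u) (s u) k).1 + sin t * (cpow (c u) (s u) k).2)).
    apply/funext => n; rewrite fctE /series /= -big_split; apply: eq_bigr => k _.
    by rewrite /v /exp_coeff /= exprMn mulrDr mulrAC.
  by apply: cvgD; [exact: is_cvg_series_exp_coeff|exact: cvg_series_cpow].
rewrite /cpoisson.
have -> : (\sum_(0 <= k <oo) ((D ^+ k / k`!%:R)%:E * iter k (jump N) (osc u t) 0%R) =
   (expR (D * mass N) + expR (D * c u) * (cos t * cos (D * s u) + sin t * sin (D * s u)))%:E)%E.
  apply/cvg_lim => //; rewrite [X in X @ _ --> _](_ : _ = EFin \o series v).
    by apply: cvg_EFin => //; exact: nearW.
  apply/funext => n; rewrite /series /= -sumEFin; apply: eq_bigr => k _.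
  rewrite iter_jump_osc mulr0 sub0r cosN sinN -EFinM; congr EFin; rewrite /v; ring.
rewrite -EFinM; congr EFin.
rewrite mulrDr -expRD addNr expR0 mulrA -expRD; congr (_ + expR _ * _); ring.
Qed.

Lemma integral_levy_law D (P : probability R R) : 0 <= D ->
  levy_increment_law D N P -> forall h, nnmeas h -> (\int[P]_x h x = cpoisson D N h)%E.
Proof.
move=> D0 PD.
have sJ := sigma_functional_cpoisson D0.
have oscP u t : (\int[P]_x osc u t x = cpoisson D N (osc u t))%E.
  have [Pc Ps] := PD u.
  have iP (f : R -> R) : measurable_fun setT f -> (forall x, `|f x| <= 1) -> P.-integrable setT (EFin \o f).
    move=> mf f1; apply: (le_integrable measurableT _ _ (finite_measure_integrable_cst P 1 measurableT)).
      exact/measurable_EFinP.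
    by move=> x _ /=; rewrite lee_fin normr1.
  have iE (f : R -> R) : P.-integrable setT (EFin \o f) ->
      (\int[P]_y (f y)%:E = (Rintegral P setT f)%:E)%E.
    by move=> fi; rewrite /Rintegral fineK//; exact: (integrable_fin_num measurableT fi).
  have iZ (a : R) (f : R -> R) : P.-integrable setT (EFin \o f) ->
      P.-integrable setT (EFin \o (fun x => a * f x)).
    by move=> fi; have := integrableZl measurableT a fi.
  have iD (f g : R -> R) : P.-integrable setT (EFin \o f) -> P.-integrable setT (EFin \o g) ->
      P.-integrable setT (EFin \o (fun x => f x + g x)).
    by move=> fi gi; have := integrableD measurableT fi gi.
  have Ic : P.-integrable setT (EFin \o (fun x => cos (u * x))).
    apply: iP; last by move=> x; rewrite ler_norml cos_geN1 cos_le1.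
    by apply: (measurableT_comp (@measurable_cos R)); exact: measurable_funM.
  have Is : P.-integrable setT (EFin \o (fun x => sin (u * x))).
    apply: iP; last by move=> x; rewrite ler_norml sin_geN1 sin_le1.
    by apply: (measurableT_comp measurable_sin); exact: measurable_funM.
  have I1 := finite_measure_integrable_cst P 1 measurableT.
  have I2 := iZ (cos t) _ Ic; have I3 := iZ (sin t) _ Is; have I23 := iD _ _ I2 I3.
  rewrite cpoisson_osc.
  transitivity (\int[P]_x (1 + (cos t * cos (u * x) + sin t * sin (u * x)))%:E)%E.
    apply: eq_integral => x _; congr EFin; rewrite /osc cosB; ring.
  rewrite iE; last exact: (iD (cst 1) _ I1 I23).
  congr EFin; rewrite (@RintegralD _ _ _ P setT (cst 1))// RintegralD// !RintegralZl// Pc Ps.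
  rewrite Rintegral_cst//= probability_setT /= mulr1; congr (_ + _).
  have -> : Rintegral leb setT (fun x => (cos (u * x) - 1) * N x) = c u - mass N.
    rewrite /c /mass -RintegralB//; [|by case: fN].
    by apply: eq_Rintegral => x _; ring.
  rewrite -/(s u); ring.
(* Total mass is read off from [cpoisson_osc]: at u = 0 and t = pi / 2, [osc] is the constant 1. *)
have J1 : cpoisson D N (fun=> 1%E) = 1%E.
  have s0 : s 0 = 0.
    rewrite /s; under eq_Rintegral do rewrite mul0r sin0 mul0r.
    by rewrite Rintegral_cst// mul0r.
  have := cpoisson_osc D 0 (pi / 2); rewrite s0 mulr0 sin0 mulr0 addr0 cos_pihalf mul0r mulr0 addr0 => H; rewrite -[RHS]H.
  congr cpoisson; apply/funext => x; by rewrite /osc mul0r sub0r cosN cos_pihalf addr0.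
have [Q QJ] := sigma_functional_probability sJ J1.
have PQ := @probability_eq_osc _ P Q.
move=> h mh; rewrite -QJ//.
apply: (sf_ext (sigma_functional_integral P) (sigma_functional_integral Q) _ mh) => A mA.
rewrite !integral_indic// !setIT; apply: PQ => // u t.
by rewrite oscP QJ//; exact: nnmeas_osc.
Qed.

End fixed_density.
End compound_poisson.

(** * Chi-square bounds *)

Section quadratic_form.
Context (R : realType).
Local Open Scope ereal_scope.

(** Reduces a Cauchy-Schwarz inequality to bounds that are linear in [a] and [b], one for each t, so
    that it can be proved under an integral or a sum. *)
Lemma sqr_le_of_linear (a b : \bar R) (K : R) : 0 <= a -> 0 <= b -> (0 < K)%R ->
  (forall t : R, (0 < t)%R -> 2%:E * a <= (t * K)%:E + t^-1%:E * b) ->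
  a * a <= K%:E * b.
Proof.
move=> a0 b0 K0 H.
case: b b0 H => [b b0 H|_ _|//]; last by rewrite gt0_muley// leey.
case: a a0 H => [a a0 H|_ H|//]; last first.
  by have := H 1%R ltr01; rewrite gt0_muley// -EFinM -EFinD leNgt ltry.
rewrite !lee_fin in a0 b0.
rewrite -!EFinM lee_fin.
have [->|an0] := eqVneq a 0%R; first by rewrite mul0r mulr_ge0// ltW.
have ap : (0 < a)%R by rewrite lt_neqAle eq_sym an0.
(* This t makes the first term on the right equal to a, leaving a <= (K / a) b. *)
have := H (a / K)%R (divr_gt0 ap K0).
rewrite -!EFinM -EFinD lee_fin divfK ?gt_eqF// invf_div => H1.
have H2 : (a <= K / a * b)%R by lra.
have := ler_wpM2l a0 H2.
by rewrite mulrA mulrCA mulfV// mulr1.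
Qed.

(** Arithmetic-geometric mean: (t K + b / t)^2 >= 4 K b. It turns a squared bound known for each
    term back into the summable form. *)
Lemma linear_of_sqr_le (a b : \bar R) (K t : R) : 0 <= a -> 0 <= b -> (0 < K)%R -> (0 < t)%R ->
  a * a <= K%:E * b -> 2%:E * a <= (t * K)%:E + t^-1%:E * b.
Proof.
move=> a0 b0 K0 t0.
case: b b0 => [b b0|_ _|//]; last by rewrite gt0_muley ?lte_fin ?invr_gt0// addey// leey.
case: a a0 => [a a0|_|//]; last by rewrite -EFinM leNgt mulyy ltry.
rewrite !lee_fin in a0 b0; rewrite -!EFinM -EFinD !lee_fin => H.
have v0 : (0 < t^-1)%R by rewrite invr_gt0.
have tv : (t * t^-1 = 1)%R by rewrite mulfV ?gt_eqF.
rewrite -ler_sqr ?nnegrE ?mulr_ge0 ?addr_ge0 ?mulr_ge0 ?(ltW t0) ?(ltW K0) ?(ltW v0)//.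
have -> : ((t * K + t^-1 * b) ^+ 2 = (t * K - t^-1 * b) ^+ 2 + 4 * (t * t^-1) * (K * b))%R by ring.
rewrite tv mulr1 exprMn.
have := sqr_ge0 (t * K - t^-1 * b)%R; rewrite -expr2 in H; lra.
Qed.

Lemma linear_young (a : \bar R) (f t : R) : 0 <= a -> (0 <= f)%R -> (0 < t)%R ->
  2%:E * (a * f%:E) <= (t * f ^+ 2)%:E + t^-1%:E * (a * a).
Proof.
move=> a0 f0 t0; have v0 : (0 < t^-1)%R by rewrite invr_gt0.
case: a a0 => [a a0|_|//]; last by rewrite mulyy gt0_muley// addey// leey.
rewrite lee_fin in a0; rewrite -!EFinM -EFinD lee_fin.
have tv : (t * t^-1 = 1)%R by rewrite mulfV ?gt_eqF.
have : (0 <= t * (f - t^-1 * a) ^+ 2)%R by rewrite mulr_ge0 ?sqr_ge0// ltW.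
have -> : (t * (f - t^-1 * a) ^+ 2 = t * f ^+ 2 - 2 * (t * t^-1) * (a * f) + (t * t^-1) * (t^-1 * (a * a)))%R by ring.
rewrite tv mul1r mulr1; lra.
Qed.

End quadratic_form.

Section chi_square_compound_poisson.
Context (R : realType).
Notation leb := (@lebesgue_measure R).
Variables (N0 F : R -> R) (K : R).
Hypotheses (fN0 : finite_density N0) (mF : measurable_fun setT F) (F0 : forall x, 0 <= F x).
(** [F] is the ratio of the Lévy densities, so [K] bounds the integral of N1^2 / N0, written without
    a division. *)
Let N1 (x : R) := F x * N0 x.
Hypotheses (fN1 : finite_density N1) (K0 : 0 < K)
  (KF : (\int[leb]_y (F y ^+ 2 * N0 y)%:E <= K%:E)%E).
Local Open Scope ereal_scope.
Implicit Types h : R -> \bar R.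

(** Cauchy-Schwarz in L^2(N0(y) dy) for [F] and h(x + y), with [linear_young] as the pointwise
    inequality. *)
Lemma jump_sqr_le h x : nnmeas h ->
  jump N1 h x * jump N1 h x <= K%:E * jump N0 (fun z => h z * h z) x.
Proof.
move=> mh; have mhh := nnmeas_mul mh mh.
have j1 := (nnmeas_jump fN1 mh).2 x; have j0 := (nnmeas_jump fN0 mhh).2 x.
have [mN0 N00 _] := fN0.
apply: sqr_le_of_linear => // t t0.
have v0 : (0 < t^-1)%R by rewrite invr_gt0.
have mhx := nnmeas_translate x mh.
have nN0 := nnmeas_density fN0; have nN1 := nnmeas_density fN1.
have mG : nnmeas (fun y : R => (F y ^+ 2 * N0 y)%:E : \bar R).
  split; last by move=> y; rewrite lee_fin mulr_ge0// sqr_ge0.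
  by apply/measurable_EFinP; apply: measurable_funM => //; exact: measurable_funX.
have m1 := nnmeas_mul mhx nN1.
have m0 := nnmeas_mul (nnmeas_mul mhx mhx) nN0.
apply: (@le_trans _ _ (t%:E * \int[leb]_y (F y ^+ 2 * N0 y)%:E +
    t^-1%:E * jump N0 (fun z => h z * h z) x)); last first.
  by rewrite leeD2r// EFinM lee_pmul2l// lte_fin.
rewrite /jump.
rewrite -(ge0_integralZl_EFin leb measurableT _ m1.1 (ler0n _ 2)); last by move=> y _; exact: m1.2.
rewrite -(ge0_integralZl_EFin leb measurableT _ mG.1 (ltW t0)); last by move=> y _; exact: mG.2.
rewrite -(ge0_integralZl_EFin leb measurableT _ m0.1 (ltW v0)); last by move=> y _; exact: m0.2.
have mG' := nnmeas_scale (ltW t0) mG; have m0' := nnmeas_scale (ltW v0) m0.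
have m1' := nnmeas_scale (ler0n R 2) m1.
rewrite -ge0_integralD//; [|by move=> y _; exact: mG'.2|exact: mG'.1|by move=> y _; exact: m0'.2|exact: m0'.1].
apply: ge0_le_integral => //.
- by move=> y _; exact: m1'.2.
- exact: m1'.1.
- by apply: emeasurable_funD; [exact: mG'.1|exact: m0'.1].
move=> y _; rewrite /N1 /= EFinM.
have -> : 2%:E * (h (x + y)%R * ((F y)%:E * (N0 y)%:E)) = (N0 y)%:E * (2%:E * (h (x + y)%R * (F y)%:E)).
  by rewrite !muleA muleC !muleA.
have -> : t%:E * (F y ^+ 2 * N0 y)%:E + t^-1%:E * (h (x + y)%R * h (x + y)%R * (N0 y)%:E) =
  (N0 y)%:E * ((t * F y ^+ 2)%:E + t^-1%:E * (h (x + y)%R * h (x + y)%R)).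
  have hh : 0 <= h (x + y)%R * h (x + y)%R by rewrite mule_ge0// mhx.2.
  rewrite ge0_muleDr//; first last.
  - by rewrite mule_ge0// lee_fin ltW.
  - by rewrite lee_fin mulr_ge0 ?(ltW t0)// sqr_ge0.
  congr (_ + _); first by rewrite -!EFinM; congr EFin; ring.
  by rewrite muleA muleC.
apply: lee_wpmul2l; first by rewrite lee_fin.
by apply: linear_young => //; exact: mhx.2.
Qed.

Lemma le_jump (N : R -> R) h1 h2 x : finite_density N -> nnmeas h1 -> nnmeas h2 ->
  (forall z, h1 z <= h2 z) -> jump N h1 x <= jump N h2 x.
Proof.
move=> fN m1 m2 h12; have nN := nnmeas_density fN.
have n1 := nnmeas_mul (nnmeas_translate x m1) nN.
have n2 := nnmeas_mul (nnmeas_translate x m2) nN.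
apply: ge0_le_integral => //; [|exact: n1.1|exact: n2.1|].
- by move=> y _; exact: n1.2.
- by move=> y _; apply: lee_wpmul2r; [exact: nN.2|exact: h12].
Qed.

Lemma iter_jump_sqr_le k h x : nnmeas h ->
  iter k (jump N1) h x * iter k (jump N1) h x <=
  (K ^+ k)%:E * iter k (jump N0) (fun z => h z * h z) x.
Proof.
move=> mh; have mhh := nnmeas_mul mh mh.
elim: k x => [|k IH] x; first by rewrite /= expr0 mul1e.
have mk1 := nnmeas_iter_jump fN1 k mh; have mk0 := nnmeas_iter_jump fN0 k mhh.
have Kk : (0 <= K ^+ k)%R by rewrite exprn_ge0 ?(ltW K0).
rewrite !iterS (le_trans (jump_sqr_le x mk1))// exprS EFinM -muleA.
apply: lee_wpmul2l; first by rewrite lee_fin ltW.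
have E := sf_scale (sigma_functional_jump fN0 x) Kk mk0; cbv beta in E; rewrite -E.
apply: le_jump => //; [exact: nnmeas_mul|exact: nnmeas_scale].
Qed.

(** The sum over the number of jumps gives exp(D K) and the normalising factors give the masses. For
    K equal to the integral of F^2 N0, the exponent is D times the integral of (F - 1)^2 N0 = (N1 -
    N0)^2 / N0. *)
Lemma cpoisson_sqr_le (D : R) h : (0 <= D)%R -> nnmeas h ->
  cpoisson D N1 h * cpoisson D N1 h <=
  (expR (D * (K + mass N0 - 2 * mass N1)))%:E * cpoisson D N0 (fun z => h z * h z).
Proof.
move=> D0 mh; have mhh := nnmeas_mul mh mh.
rewrite /cpoisson.
set S1 := \sum_(0 <= k <oo) _; set S0 := \sum_(0 <= k <oo) _.
pose w k : R := (D ^+ k / k`!%:R)%R.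
have w0 k : (0 <= w k)%R by rewrite divr_ge0// exprn_ge0.
have a0 k : 0 <= iter k (jump N1) h 0%R by exact: (nnmeas_iter_jump fN1 k mh).2.
have b0 k : 0 <= iter k (jump N0) (fun z => h z * h z) 0%R by exact: (nnmeas_iter_jump fN0 k mhh).2.
have S10 : 0 <= S1 by apply: nneseries_ge0 => k _ _; rewrite mule_ge0// lee_fin w0.
have S00 : 0 <= S0 by apply: nneseries_ge0 => k _ _; rewrite mule_ge0// lee_fin w0.
have sumK : \sum_(0 <= k <oo) (w k * K ^+ k)%:E = (expR (D * K))%:E.
  apply/cvg_lim => //; rewrite [X in X @ _ --> _](_ : _ = EFin \o series (exp_coeff (D * K)%R)).
    by apply: cvg_EFin; [exact: nearW|exact: is_cvg_series_exp_coeff].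
  apply/funext => n; rewrite /series /= -sumEFin; apply: eq_bigr => k _.
  by rewrite /w /exp_coeff /= exprMn mulrAC.
have S1S0 : S1 * S1 <= (expR (D * K))%:E * S0.
  (* Cauchy-Schwarz over the number of jumps: the linear form of the bound for k jumps, at the same
     t for all k, is weighted by [w k] and summed. *)
  apply: (@sqr_le_of_linear _ S1 S0 (expR (D * K)) S10 S00 (expR_gt0 _)).
  move=> t t0; have v0 : (0 < t^-1)%R by rewrite invr_gt0.
  rewrite EFinM -sumK.
  rewrite -nneseriesZl; last by move=> k _; rewrite mule_ge0// lee_fin w0.
  rewrite -nneseriesZl; last by move=> k _; rewrite lee_fin mulr_ge0// exprn_ge0// ltW.
  rewrite -nneseriesZl; last by move=> k _; rewrite mule_ge0// lee_fin w0.
  rewrite -nneseriesD; first last.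
  - by move=> k _ _; rewrite mule_ge0// ?mule_ge0// lee_fin ?w0// ltW.
  - by move=> k _ _; rewrite mule_ge0// lee_fin ?mulr_ge0 ?exprn_ge0// ltW.
  apply: lee_nneseries => [k _|k _].
    by rewrite mule_ge0// mule_ge0// lee_fin w0.
  have := linear_of_sqr_le (a0 k) (b0 k) (exprn_gt0 k K0) t0 (iter_jump_sqr_le k 0%R mh).
  move/(lee_wpmul2l (_ : 0 <= (w k)%:E)) => /(_ (w0 k)).
  rewrite ge0_muleDr; first last.
  - by rewrite mule_ge0// lee_fin ltW.
  - by rewrite lee_fin mulr_ge0 ?exprn_ge0// ltW.
  rewrite -/(w k) muleCA [X in _ <= _ + X]muleCA -EFinM => H.
  by move: H; rewrite mulrCA EFinM.
have -> : (expR (- (D * mass N1)))%:E * S1 * ((expR (- (D * mass N1)))%:E * S1) =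
    (expR (- (D * mass N1)) * expR (- (D * mass N1)))%:E * (S1 * S1).
  by rewrite EFinM !muleA; congr (_ * _); rewrite -!muleA; congr (_ * _); rewrite muleC.
rewrite (le_trans (lee_wpmul2l _ S1S0)) ?lee_fin ?mulr_ge0 ?expR_ge0//.
rewrite !muleA -!EFinM -!expRD; apply: lee_wpmul2r => //.
by rewrite lee_fin ler_expR; lra.
Qed.

End chi_square_compound_poisson.

(** * Product laws and the two-point risk bound *)

Section iid_expectation.
Context (R : realType).
Local Open Scope ereal_scope.
Implicit Types P : probability R R.

(** The parameter space [T] is arbitrary because the induction moves the first observation into it,
    passing from [T] to [T * R]. *)
Lemma nnmeas_iid_expect P n d (T : measurableType d) (h : T * n.-tuple R -> \bar R) :
  nnmeas h -> nnmeas (fun w => iid_expect P (fun t => h (w, t))).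
Proof.
elim: n d T h => [|n IH] d T h [mh h0] /=.
  split; last by move=> w; exact: h0.
  exact: (measurableT_comp mh (pair2_measurable _)).
pose g (p : (T * R) * n.-tuple R) : \bar R := h (p.1.1, [tuple of p.1.2 :: p.2]).
have mg : nnmeas g.
  split; last by move=> p; exact: h0.
  apply: (measurableT_comp mh); apply/measurable_fun_pairP; split => /=.
    exact: (measurableT_comp measurable_fst measurable_fst).
  apply: (@measurable_cons _ _ _ _ (fun p : (T * R) * n.-tuple R => p.1.2) n (fun p : (T * R) * n.-tuple R => p.2)).
    exact: (measurableT_comp measurable_snd measurable_fst).
  exact: measurable_snd.
have [mE E0] := IH _ _ g mg.
split; last by move=> w; apply: integral_ge0 => z _; exact: (E0 (w, z)).
exact: (@measurable_fun_fubini_tonelli_F _ _ _ _ _ P _ mE E0).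
Qed.

Section tail.
Variables (P : probability R R) (n : nat) (h : n.+1.-tuple R -> \bar R).
Hypothesis mh : nnmeas h.

Lemma nnmeas_tail z : nnmeas (fun t : n.-tuple R => h [tuple of z :: t]).
Proof.
case: mh => m0 h0; split; last by move=> t; exact: h0.
apply: (measurableT_comp m0).
exact: (@measurable_cons _ _ _ _ (fun=> z) n id).
Qed.

Lemma nnmeas_iid_tail :
  nnmeas (fun z => iid_expect P (fun t : n.-tuple R => h [tuple of z :: t])).
Proof.
apply: (@nnmeas_iid_expect P n _ R (fun p => h [tuple of p.1 :: p.2])).
case: mh => m0 h0; split; last by move=> t; exact: h0.
apply: (measurableT_comp m0).
exact: (@measurable_cons _ _ _ _ fst n snd).
Qed.

End tail.

Lemma sigma_functional_iid_expect P n : sigma_functional (@iid_expect R P n).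
Proof.
elim: n => [|n IH] /=; first by split => // h mh; exact: mh.2.
pose K (h : n.+1.-tuple R -> \bar R) z := iid_expect P (fun t : n.-tuple R => h [tuple of z :: t]).
have mK h : nnmeas h -> nnmeas (K h) by move=> mh; exact: nnmeas_iid_tail.
have sP := sigma_functional_integral P.
split.
- by move=> h mh; apply: (sf_ge0 sP); exact: mK.
- move=> c h c0 mh; rewrite -(sf_scale sP c0 (mK _ mh)).
  by apply: eq_integral => z _; rewrite (sf_scale IH)//; exact: nnmeas_tail.
- move=> f g mf mg; rewrite -(sf_add sP (mK _ mf) (mK _ mg)).
  by apply: eq_integral => z _; rewrite (sf_add IH)//; exact: nnmeas_tail.
- move=> h mh; have mKn i := mK _ (mh i).
  rewrite -(sf_series sP mKn).
  by apply: eq_integral => z _; rewrite (sf_series IH)// => i; exact: nnmeas_tail.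
Qed.

Lemma le_iid_expect P n (f g : n.-tuple R -> \bar R) : nnmeas f -> nnmeas g ->
  (forall t, f t <= g t) -> iid_expect P f <= iid_expect P g.
Proof.
elim: n f g => [|n IH] f g mf mg fg; first exact: fg.
have mf' := nnmeas_iid_tail P mf; have mg' := nnmeas_iid_tail P mg.
apply: ge0_le_integral => //; [|exact: mf'.1|exact: mg'.1|].
- by move=> z _; exact: mf'.2.
- by move=> z _; apply: IH; [exact: nnmeas_tail|exact: nnmeas_tail|move=> t; exact: fg].
Qed.

Lemma iid_expect1 P n : iid_expect P (fun _ : n.-tuple R => 1) = 1.
Proof.
elim: n => [//|n IH] /=; under eq_integral do rewrite IH.
by rewrite integral_cst// mul1e [LHS](@probability_setT _ _ _ P).
Qed.

(** Tensorization: [H] is applied in the first coordinate to the partial expectation over the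
    others, and the induction hypothesis inside the integral. *)
Lemma iid_expect_sqr_le P0 P1 (K : R) n (h : n.-tuple R -> \bar R) : (0 <= K)%R ->
  (forall f : R -> \bar R, nnmeas f ->
    \int[P1]_x f x * \int[P1]_x f x <= K%:E * \int[P0]_x (f x * f x)) ->
  nnmeas h ->
  iid_expect P1 h * iid_expect P1 h <= (K ^+ n)%:E * iid_expect P0 (fun t => h t * h t).
Proof.
move=> K0 H; elim: n h => [|n IH] h mh; first by rewrite expr0 mul1e.
have mhh := nnmeas_mul mh mh.
have m1 := nnmeas_iid_tail P1 mh; have m0 := nnmeas_iid_tail P0 mhh.
have Kn : (0 <= K ^+ n)%R by rewrite exprn_ge0.
rewrite /= (le_trans (H _ m1))// exprS EFinM -muleA; apply: lee_wpmul2l; first by rewrite lee_fin.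
rewrite -(ge0_integralZl_EFin P0 measurableT _ m0.1 Kn); last by move=> z _; exact: m0.2.
have m0' := nnmeas_scale Kn m0; have m11 := nnmeas_mul m1 m1.
apply: ge0_le_integral => //; [|exact: m11.1|exact: m0'.1|].
- by move=> z _; exact: m11.2.
- by move=> z _; apply: IH; exact: nnmeas_tail.
Qed.

(** Let B be the event that [T] is within delta / 2 of [th1]. If P1(B) >= 1/2, the chi-square bound
    gives P0(B) >= 1 / (4 A), and on B the estimator is at least delta / 2 away from [th0];
    otherwise the complement of B has P1-probability above 1/2. Chebyshev's factor delta^2 / 4 turns
    1 / (4 A) into the constant 1 / (16 A). *)
Lemma two_point_risk P0 P1 (K A delta th0 th1 : R) n (T : n.-tuple R -> R) :
  (0 <= K)%R -> (1 <= A)%R -> (0 < delta)%R -> (K ^+ n <= A)%R ->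
  (delta <= `|th1 - th0|)%R ->
  (forall f : R -> \bar R, nnmeas f ->
    \int[P1]_x f x * \int[P1]_x f x <= K%:E * \int[P0]_x (f x * f x)) ->
  measurable_fun setT T ->
  (delta ^+ 2 / (16 * A))%:E <= iid_expect P0 (fun t => ((T t - th0) ^+ 2)%:E) \/
  (delta ^+ 2 / (16 * A))%:E <= iid_expect P1 (fun t => ((T t - th1) ^+ 2)%:E).
Proof.
move=> K0 A1 d0 KA dth H mT.
have A0 : (0 < A)%R by rewrite (lt_le_trans ltr01).
pose B : set (n.-tuple R) := [set t | `|T t - th1| < delta / 2]%R.
have mN : measurable_fun setT (fun t => `|T t - th1|%R).
  by apply: measurableT_comp => //; exact: measurable_funB.
have mB : measurable B.
  have := mN measurableT _ (measurable_itv `]-oo, (delta / 2)%R[).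
  rewrite setTI; congr measurable; apply/seteqP; split => t /=; by rewrite in_itv.
have mBc : measurable (~` B) by exact: measurableC.
have nB := nnmeas_indic R mB; have nBc := nnmeas_indic R mBc.
have msq th : nnmeas (fun t => ((T t - th) ^+ 2)%:E : \bar R).
  split; last by move=> t; rewrite lee_fin sqr_ge0.
  by apply/measurable_EFinP; apply: measurable_funX; exact: measurable_funB.
have d4 : (0 <= delta ^+ 2 / 4)%R by rewrite divr_ge0// sqr_ge0.
have sE P := sigma_functional_iid_expect P n.
have chebyshev P th (C : set (n.-tuple R)) : measurable C ->
    (forall t, C t -> (delta / 2 <= `|T t - th|)%R) ->
    (delta ^+ 2 / 4)%:E * iid_expect P (fun t => (\1_C t)%:E) <=
    iid_expect P (fun t => ((T t - th) ^+ 2)%:E).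
  move=> mC Cth; have nC := nnmeas_indic R mC.
  rewrite -(sf_scale (sE P) d4 nC); apply: le_iid_expect => //.
    exact: nnmeas_scale.
  move=> t; rewrite -EFinM lee_fin indicE; have [tC|_] := boolP (t \in C); last first.
    by rewrite mulr0 sqr_ge0.
  rewrite mulr1 -[leRHS]real_normK ?num_real//.
  have -> : (delta ^+ 2 / 4 = (delta / 2) ^+ 2)%R by field.
  rewrite ler_sqr ?nnegrE ?normr_ge0 ?divr_ge0 ?(ltW d0)//; apply: Cth; exact: set_mem.
set p1 := iid_expect P1 (fun t => (\1_B t)%:E).
have sum1 : iid_expect P1 (fun t => (\1_B t)%:E) + iid_expect P1 (fun t => (\1_(~` B) t)%:E) = 1.
  rewrite -(sf_add (sE P1) nB nBc) -[RHS](iid_expect1 P1 n); congr iid_expect.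
  apply/funext => t; rewrite -EFinD !indicE in_setC.
  by case: (t \in B); rewrite /= ?addr0 ?add0r.
have [p1h|p1h] := leP (2^-1%:E) p1.
  left; apply: le_trans (chebyshev P0 th0 B mB _); last first.
    move=> t /= Bt.
    have : (`|th1 - th0| <= `|T t - th1| + `|T t - th0|)%R.
      have -> : (th1 - th0 = - (T t - th1) + (T t - th0))%R by ring.
      by rewrite (le_trans (ler_normD _ _))// normrN.
    have Bt' : (`|T t - th1| < delta / 2)%R := Bt.
    by move: Bt' dth; lra.
  have := iid_expect_sqr_le K0 H nB.
  (* An indicator is its own square, so the second-moment bound reads P1(B)^2 <= K^n P0(B). *)
  have -> : (fun t => (\1_B t)%:E * (\1_B t)%:E : \bar R) = (fun t => (\1_B t)%:E).
    by apply/funext => t; rewrite -EFinM indicE -expr2; case: (t \in B); rewrite ?expr1n ?expr0n.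
  rewrite -/p1; set q0 := iid_expect P0 _ => H1.
  have q00 : 0 <= q0 by exact: (sf_ge0 (sE P0)).
  have p11 : 0 <= p1 by exact: (sf_ge0 (sE P1)).
  have H2 : 4^-1%:E <= A%:E * q0.
    apply: (@le_trans _ _ (p1 * p1)).
      have -> : 4^-1%:E = 2^-1%:E * 2^-1%:E :> \bar R by rewrite -EFinM; congr EFin; field.
      by apply: lee_pmul.
    by rewrite (le_trans H1)//; apply: lee_wpmul2r.
  have -> : (delta ^+ 2 / (16 * A))%:E = (delta ^+ 2 / 4 / A)%:E * 4^-1%:E.
    by rewrite -EFinM; congr EFin; field; rewrite gt_eqF.
  have -> : (delta ^+ 2 / 4)%:E * q0 = (delta ^+ 2 / 4 / A)%:E * (A%:E * q0).
    by rewrite muleA -EFinM divfK ?gt_eqF.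
  by apply: lee_wpmul2l => //; rewrite lee_fin divr_ge0// ltW.
right; apply: le_trans (chebyshev P1 th1 (~` B) mBc _); last first.
  by move=> t /= /negP; rewrite -leNgt.
have p1f : p1 \is a fin_num.
  rewrite ge0_fin_numE; first by rewrite (lt_trans p1h)// ltry.
  exact: (sf_ge0 (sE P1)).
have : iid_expect P1 (fun t => (\1_(~` B) t)%:E) = 1 - p1.
  by rewrite -sum1 addeAC subee// add0e.
move=> ->; rewrite -(fineK p1f) -EFinB -EFinM lee_fin.
move: p1h; rewrite -(fineK p1f) lte_fin; set p := fine p1 => p12.
have -> : (delta ^+ 2 / (16 * A) = delta ^+ 2 / 4 * (A^-1 / 4))%R by field; rewrite gt_eqF.
apply: ler_wpM2l => //.
have : (A^-1 <= 1)%R by rewrite invf_le1.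
by rewrite /=; lra.
Qed.

End iid_expectation.

(** * Bumps in Hölder classes *)

Section bump.
Context (R : realType).
Implicit Types (x u h : R) (q : {poly R}).

(** Meant for the square of the positive part, whose kink at 0 is covered by the same quadratic
    remainder bound as every other point. *)
Lemma is_derive_quadratic_bound (f : R -> R) (x d C : R) :
  (forall h, `|f (h + x) - f x - h * d| <= C * h ^+ 2) -> is_derive x (1 : R) f d.
Proof.
move=> H.
have K : h^-1 *: (f (h *: (1 : R) + x) - f x) @[h --> 0^'] --> d.
  apply/cvgrPdist_le => e e0.
  have C1 : 0 < `|C| + 1 by rewrite ltr_wpDl.
  near=> h.
  have h0 : h != 0 by near: h; exact: nbhs_dnbhs_neq.
  have he : `|h| <= e / (`|C| + 1).
    near: h; apply: dnbhs0_le; rewrite divr_gt0//.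
  have -> : d - h^-1 *: (f (h *: (1 : R) + x) - f x) =
      - (h^-1 * (f (h + x) - f x - h * d)).
    by rewrite /GRing.scale /= mulr1; field.
  rewrite normrN normrM normfV.
  apply: (@le_trans _ _ (`|h|^-1 * (C * h ^+ 2))); first by rewrite ler_wpM2l// invr_ge0.
  have -> : `|h|^-1 * (C * h ^+ 2) = C * `|h|.
    by rewrite -[h ^+ 2]real_normK ?num_real//; field; rewrite normr_eq0.
  apply: (@le_trans _ _ ((`|C| + 1) * `|h|)).
    by rewrite ler_wpM2r// (le_trans (ler_norm _))// lerDl.
  by rewrite mulrC -ler_pdivlMr.
have Dx : derivable f x 1 by apply/cvg_ex; exists d.
by apply: DeriveDef => //; exact: cvg_lim K.
Unshelve. all: by end_near. Qed.

Definition pospart u : R := Num.max u 0.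

Lemma pospart_ge0 u : 0 <= pospart u.
Proof. by rewrite /pospart le_max lexx orbT. Qed.

Lemma pospartM u : pospart u * u = pospart u ^+ 2.
Proof. by rewrite /pospart expr2; case: leP => //; rewrite !mul0r. Qed.

Lemma pospartXS i u : pospart u ^+ i.+2 = u * pospart u ^+ i.+1.
Proof. by rewrite exprS [in RHS]exprS mulrA [u * _]mulrC pospartM exprS mulrA. Qed.

Lemma is_derive_pospart_sqr u :
  is_derive u (1 : R) (fun v => pospart v ^+ 2) (2 * pospart u).
Proof.
apply: (@is_derive_quadratic_bound _ _ _ 1) => h.
rewrite mul1r ler_norml /pospart.
by case: (leP u 0) => u0; case: (leP (h + u) 0) => hu; apply/andP; split; nra.
Qed.

(* pospart v ^ (i + 3) = v * pospart v ^ (i + 2), so only the square needs an argument at 0. *)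
Lemma is_derive_pospartX i u :
  is_derive u (1 : R) (fun v => pospart v ^+ i.+2) (i.+2%:R * pospart u ^+ i.+1).
Proof.
elim: i => [|i IH]; first exact: is_derive_pospart_sqr.
have -> : (fun v => pospart v ^+ i.+3) = (id : R -> R) * (fun v => pospart v ^+ i.+2).
  by apply/funext => v; rewrite fctE pospartXS.
apply: is_derive_eq; rewrite /GRing.scale /= mulr1.
by rewrite mulrCA -pospartXS -[X in _ + X]mul1r -mulrDl natr1.
Qed.

(** A class stable under differentiation: each derivative lowers the exponent [j] by one and changes
    only the polynomial factor, according to [bump_step]. *)
Definition bumpW q j x : R := q.[x] * pospart (1 - x ^+ 2) ^+ j.

Definition bump_step (j : nat) q : {poly R} :=
  q^`() * (1 - 'X ^+ 2) - (2 * j%:R) *: ('X * q).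

Lemma is_derive_bumpW q j x :
  is_derive x (1 : R) (bumpW q j.+2) (bumpW (bump_step j.+2 q) j.+1 x).
Proof.
have d1 : is_derive x (1 : R) (fun v : R => 1 - v ^+ 2) (- (2 * x)).
  have -> : (fun v : R => 1 - v ^+ 2) = cst 1 - (id : R -> R) ^+ 2.
    by apply/funext => v; rewrite !fctE.
  apply: is_derive_eq; rewrite /GRing.scale /= mulr1; ring.
have d2 := @is_derive1_comp R _ (fun v : R => 1 - v ^+ 2) _ _ _ (is_derive_pospartX j (1 - x ^+ 2)) d1.
have d3 := is_derive_poly q x.
have -> : bumpW q j.+2 = (fun v => q.[v]) * ((fun v => pospart v ^+ j.+2) \o (fun v : R => 1 - v ^+ 2)).
  by [].
apply: is_derive_eq; rewrite /GRing.scale /= /bumpW /bump_step.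
rewrite !hornerE /=.
have -> : pospart (1 - x ^+ 2) ^+ j.+2 = pospart (1 - x ^+ 2) ^+ j.+1 * (1 - x ^+ 2).
  by rewrite pospartXS mulrC.
ring.
Qed.

Lemma bumpW_bounded q j : (0 < j)%N -> exists2 A, 0 <= A & forall x, `|bumpW q j x| <= A.
Proof.
move=> j0; exists (\sum_(i < size q) `|q`_i|); first exact: sumr_ge0.
move=> x; have [x1|x1] := leP `|x| 1.
  rewrite normrM -[leRHS]mulr1 ler_pM//.
    rewrite horner_coef (le_trans (ler_norm_sum _ _ _))// ler_sum// => i _.
    by rewrite normrM normrX ler_piMr// exprn_ile1.
  rewrite normrX (ger0_norm (pospart_ge0 _)) exprn_ile1 ?pospart_ge0//.
  by rewrite /pospart ge_max ler01 andbT gerBl sqr_ge0.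
have -> : bumpW q j x = 0.
  rewrite /bumpW /pospart max_r; first by rewrite expr0n -[j]prednK//= mulr0.
  rewrite subr_le0 -[x ^+ 2]real_normK ?num_real// exprn_ege1// ltW//.
by rewrite normr0 sumr_ge0.
Qed.

Lemma lipschitz_of_derivative (f df : R -> R) (A : R) :
  (forall x, is_derive x (1 : R) f (df x)) -> (forall x, `|df x| <= A) ->
  forall x y, `|f x - f y| <= A * `|x - y|.
Proof.
move=> Hf HA x y; wlog yx : x y / y <= x.
  by move=> W; have [/W//|/ltW/W] := leP y x; rewrite distrC (distrC y).
have cf : {within `[y, x], continuous f}.
  exact/continuous_subspaceT/(is_derive_continuous Hf).
have [c _ ->] := MVT_segment yx (fun z _ => Hf z) cf.
by rewrite normrM ler_wpM2r.
Qed.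

(** The Lipschitz bound serves distances at most 1 and boundedness the larger ones. The summand 1
    makes the constant positive, as a later division by it requires. *)
Lemma holder_of_lipschitz (f : R -> R) (A0 A1 g : R) : 0 <= A0 -> 0 <= A1 -> 0 < g -> g <= 1 ->
  (forall x, `|f x| <= A0) -> (forall x y, `|f x - f y| <= A1 * `|x - y|) ->
  forall x y, `|f x - f y| <= (A1 + 2 * A0 + 1) * `|x - y| `^ g.
Proof.
move=> A00 A10 g0 g1 f0 f1 x y.
have P0 : 0 <= `|x - y| `^ g by exact: powR_ge0.
have [xy|xy] := leP `|x - y| 1.
  apply: (le_trans (f1 x y)).
  apply: (@le_trans _ _ (A1 * `|x - y| `^ g)); last by rewrite ler_wpM2r//; lra.
  rewrite ler_wpM2l//.
  have [->|xy0] := eqVneq `|x - y| 0; first by exact: powR_ge0.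
  by rewrite ger1_powR// xy andbT lt_neqAle eq_sym xy0 normr_ge0.
apply: (@le_trans _ _ (2 * A0)).
  by rewrite (le_trans (ler_normB _ _))//; have := f0 x; have := f0 y; lra.
apply: (@le_trans _ _ ((2 * A0) * `|x - y| `^ g)); last by rewrite ler_wpM2r//; lra.
rewrite ler_peMr//; first by rewrite mulr_ge0.
by rewrite -(powRr0 `|x - y|) ler_powR// ltW.
Qed.

(** The successive derivatives are carried as an explicit family, so sums and rescalings are handled
    without computing [derive1n]. *)
Record holder_chain (l : nat) (g L : R) (F : nat -> R -> R) : Prop := HolderChain {
  hc_derive : forall k, (k < l)%N -> forall x, is_derive x (1 : R) (F k) (F k.+1 x);
  hc_holder : forall x y, `|F l x - F l y| <= L * `|x - y| `^ g }.

Lemma holder_chainD l g L1 L2 F1 F2 : holder_chain l g L1 F1 -> holder_chain l g L2 F2 ->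
  holder_chain l g (L1 + L2) (fun k x => F1 k x + F2 k x).
Proof.
move=> [d1 h1] [d2 h2]; split.
  move=> k kl x; have := d1 k kl x; have := d2 k kl x => a b.
  exact: is_deriveD.
move=> x y; have -> : F1 l x + F2 l x - (F1 l y + F2 l y) = (F1 l x - F1 l y) + (F2 l x - F2 l y) by ring.
by rewrite (le_trans (ler_normD _ _))// mulrDl lerD.
Qed.

Lemma holder_class_chain (beta L : R) F :
  holder_chain (lfloor beta) (beta - (lfloor beta)%:R) L F -> holder_class beta L (F 0%N).
Proof.
set l := lfloor beta => -[dF hF].
have E k : (k <= l)%N -> derive1n k (F 0%N) = F k.
  elim: k => [//|k IH] kl; rewrite derive1nS IH; last exact: ltnW.
  by apply/funext => x; rewrite derive1E; exact: (@derive_val _ _ _ _ _ _ _ (dF k kl x)).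
split => [k kl x|x y]; last by rewrite E.
by rewrite E ?(ltnW kl)//; exact: (@ex_derive _ _ _ _ _ _ _ (dF k kl x)).
Qed.

Fixpoint bump_poly (m k : nat) : {poly R} :=
  if k is k'.+1 then bump_step (m - k') (bump_poly m k') else 1.

(** The exponent l + 2 leaves a factor of power 2 in the l-th derivative, which is thus still
    differentiable with bounded derivative: bounded and Lipschitz, hence Hölder. *)
Lemma bump_holder_chain (l : nat) (g : R) : 0 < g -> g <= 1 ->
  exists2 L, 0 < L & holder_chain l g L (fun k => bumpW (bump_poly l.+2 k) (l.+2 - k)).
Proof.
move=> g0 g1.
have dW k x : (k <= l)%N -> is_derive x (1 : R) (bumpW (bump_poly l.+2 k) (l.+2 - k))
    (bumpW (bump_poly l.+2 k.+1) (l.+2 - k.+1) x).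
  move=> kl; rewrite /= subSS !subSn//; last exact: leqW.
  exact: is_derive_bumpW.
have [A0 A00 HA0] : exists2 A, 0 <= A & forall x, `|bumpW (bump_poly l.+2 l) (l.+2 - l) x| <= A.
  by apply: bumpW_bounded; rewrite subn_gt0.
have [A1 A10 HA1] : exists2 A, 0 <= A & forall x, `|bumpW (bump_poly l.+2 l.+1) (l.+2 - l.+1) x| <= A.
  by apply: bumpW_bounded; rewrite subn_gt0.
exists (A1 + 2 * A0 + 1); first lra.
split => [k kl x|]; first exact/dW/ltnW.
apply: holder_of_lipschitz => // x y.
exact: (lipschitz_of_derivative (fun z => dW l z (leqnn _))).
Qed.

Definition bump_fun (m : nat) x : R := pospart (1 - x ^+ 2) ^+ m.

(** With l + g = beta, a height proportional to h^beta gives a Hölder constant independent of h. *)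
Lemma scaled_holder_chain (l : nat) (g L a p h : R) F : 0 < h ->
  holder_chain l g L F ->
  holder_chain l g (`|a| / h `^ (l%:R + g) * L) (fun k x => a / h ^+ k * F k ((x - p) / h)).
Proof.
move=> h0 [dF hF]; split.
  move=> k kl x.
  have dl : is_derive x (1 : R) (fun v : R => (v - p) / h) h^-1.
    have -> : (fun v : R => (v - p) / h) = h^-1 \*: ((id : R -> R) - cst p).
      by apply/funext => v; rewrite !fctE /= mulrC.
    by apply: is_derive_eq; rewrite subr0 /GRing.scale /= mulr1.
  have dc := @is_derive1_comp R _ (fun v : R => (v - p) / h) _ _ _ (dF k kl ((x - p) / h)) dl.
  have -> : (fun x => a / h ^+ k * F k ((x - p) / h)) =
      (a / h ^+ k) \*: (F k \o (fun v : R => (v - p) / h)) by [].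
  apply: is_derive_eq; rewrite /GRing.scale /= exprSr invfM; ring.
move=> x y; rewrite -mulrBr normrM normrM normfV (ger0_norm (exprn_ge0 _ (ltW h0))).
apply: (le_trans (ler_wpM2l _ (hF _ _))); first by rewrite divr_ge0// exprn_ge0// ltW.
have -> : (x - p) / h - (y - p) / h = (x - y) / h by ring.
rewrite normrM normfV (gtr0_norm h0) powRM ?invr_ge0 ?(ltW h0)//.
have -> : h^-1 `^ g = (h `^ g)^-1.
  by rewrite -powR_inv1 ?ltW// -powRrM mulN1r powRN.
rewrite powRD; last by apply/implyP => _; rewrite gt_eqF.
rewrite powR_mulrn ?(ltW h0)// invfM.
by rewrite le_eqVlt; apply/orP; left; apply/eqP; ring.
Qed.

Lemma lfloorP (beta : R) : 0 < beta ->
  0 < beta - (lfloor beta)%:R /\ beta - (lfloor beta)%:R <= 1.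
Proof.
move=> b0; have /andP[] := ceil_itv beta.
have c1 : (0 <= Num.ceil beta - 1)%R by rewrite subr_ge0 -gtz0_ge1 ceil_gt0.
have -> : (Num.ceil beta - 1)%:~R = (lfloor beta)%:R :> R.
  by rewrite /lfloor natr_absz ger0_norm.
have -> : (Num.ceil beta)%:~R = (Num.ceil beta - 1)%:~R + 1 :> R.
  by rewrite rmorphB /= subrK.
have -> : (Num.ceil beta - 1)%:~R = (lfloor beta)%:R :> R.
  by rewrite /lfloor natr_absz ger0_norm.
lra.
Qed.

End bump.

(** * The pair of Lévy densities and their chi-square distance *)

Section hypotheses_pair.
Context (R : realType).
Notation leb := (@lebesgue_measure R).
Implicit Types x : R.

Lemma bump_ge0 m x : 0 <= bump_fun m x.
Proof. by rewrite exprn_ge0// pospart_ge0. Qed.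

Lemma bump_le1 m x : bump_fun m x <= 1.
Proof.
rewrite /bump_fun exprn_ile1 ?pospart_ge0// /pospart ge_max ler01 andbT gerBl.
exact: sqr_ge0.
Qed.

Lemma bump_out m x : 1 <= `|x| -> bump_fun m.+1 x = 0.
Proof.
move=> x1; rewrite /bump_fun /pospart max_r ?expr0n//.
by rewrite subr_le0 -[x ^+ 2]real_normK ?num_real// exprn_ege1.
Qed.

Lemma bump0 m : bump_fun m (0 : R) = 1.
Proof. by rewrite /bump_fun /pospart expr0n /= subr0 max_l// expr1n. Qed.

Lemma bump_inner m x : `|x| <= 2^-1 -> (3 / 4) ^+ m <= bump_fun m x.
Proof.
move=> x1; rewrite /bump_fun lerXn2r ?nnegrE ?pospart_ge0//.
rewrite /pospart le_max; apply/orP; left.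
have : x ^+ 2 <= 2^-1 ^+ 2.
  by rewrite -[x ^+ 2]real_normK ?num_real// lerXn2r ?nnegrE.
lra.
Qed.

Lemma continuous_bump m : continuous (bump_fun m.+2 : R -> R).
Proof.
have -> : bump_fun m.+2 = bumpW 1 m.+2 :> (R -> R).
  by apply/funext => x; rewrite /bumpW hornerC mul1r.
exact: is_derive_continuous (is_derive_bumpW 1 m).
Qed.

Lemma measurable_bump m (p h : R) : measurable_fun setT (fun x => bump_fun m.+2 ((x - p) / h)).
Proof.
apply: (@measurableT_comp _ _ _ _ _ _ (bump_fun m.+2 : R -> R) _ (fun x => (x - p) / h)).
  by apply: continuous_measurable_fun; exact: continuous_bump.
by apply: measurable_funM => //; exact: measurable_funB.
Qed.

Lemma continuous_inv_max (r : R) : 0 < r -> continuous (fun x : R => (Num.max x r)^-1).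
Proof.
move=> r0 x; apply: cvgV; first by rewrite gt_eqF// lt_max r0 orbT.
have E : (fun y : R => Num.max y r) = (fun y => 2^-1 * (y + r + `|y - r|)).
  by apply/funext => y; case: leP => yr; [rewrite ler0_norm ?subr_le0//|rewrite gtr0_norm ?subr_gt0//]; field.
rewrite E; have -> : Num.max x r = 2^-1 * (x + r + `|x - r|) by rewrite -(congr1 (@^~ x) E).
apply: cvgM; first exact: cvg_cst.
apply: cvgD; first by apply: cvgD; [exact: cvg_id|exact: cvg_cst].
by apply: cvg_norm; apply: cvgB; [exact: cvg_id|exact: cvg_cst].
Qed.

Lemma measurable_inv_max (f : R -> R) (r : R) : 0 < r -> measurable_fun setT f ->
  measurable_fun setT (fun x => (Num.max (f x) r)^-1).
Proof.
move=> r0 mf; apply: (@measurableT_comp _ _ _ _ _ _ (fun x : R => (Num.max x r)^-1)) => //.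
by apply: continuous_measurable_fun; exact: continuous_inv_max.
Qed.

Lemma integrable_supported (f : R -> R) (p h A : R) : measurable_fun setT f ->
  (forall x, `|f x| <= A) -> (forall x, h <= `|x - p| -> f x = 0) -> 0 < h ->
  leb.-integrable setT (EFin \o f) /\ (\int[leb]_x `|f x|%:E <= (A * (2 * h))%:E)%E.
Proof.
move=> mf fA f0 h0.
have mI : measurable `[p - h, p + h]%classic by exact: measurable_itv.
have A0 : 0 <= A by rewrite (le_trans (normr_ge0 (f 0))).
have I : (\int[leb]_x (A * \1_`[p - h, p + h]%classic x)%:E = (A * (2 * h))%:E)%E.
  under eq_integral do rewrite EFinM.
  rewrite ge0_integralZl_EFin//; last exact/measurable_EFinP/measurable_indic.
  rewrite integral_indic// setIT.
  rewrite [X in (_ * X)%E](_ : _ = (2 * h)%:E); last first.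
    apply: (etrans (lebesgue_measure_itv `[p - h, p + h])).
    rewrite /= lte_fin ifT; last lra.
    by rewrite -EFinB; congr EFin; ring.
  by rewrite -EFinM.
have le x : `|f x| <= A * \1_`[p - h, p + h]%classic x.
  rewrite indicE; have [xI|xI] := boolP (x \in `[p - h, p + h]%classic).
    by rewrite mulr1.
  rewrite mulr0 f0 ?normr0//; rewrite leNgt; apply: contra xI => xh.
  by apply: mem_set; rewrite /= in_itv/=; move: xh; rewrite ltr_norml; lra.
have B : (\int[leb]_x `|f x|%:E <= (A * (2 * h))%:E)%E.
  rewrite -I; apply: ge0_le_integral => //.
  - by apply/measurable_EFinP; apply: measurableT_comp.
  - by apply/measurable_EFinP; apply: measurable_funM => //; exact: measurable_indic.
  - by move=> x _; rewrite lee_fin.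
split => //; apply/integrableP; split; first exact/measurable_EFinP.
by rewrite (le_lt_trans B)// ltry.
Qed.

Variables (m : nat) (x0 c beta r : R).
Hypotheses (x00 : x0 != 0) (c0 : 0 < c) (rE : r = `|x0| / 2).

Let r0 : 0 < r.
Proof. by rewrite rE divr_gt0// normr_gt0. Qed.

(* On the support of the bump [Num.max `|x| r] is [`|x|], so this is g(x) / x; the maximum
   only makes the density continuous at 0. *)
Definition bump_density (h x : R) : R :=
  c * h `^ beta * bump_fun m.+2 ((x - x0) / h) / Num.max `|x| r.

Section one_density.
Variable h : R.
Hypotheses (h0 : 0 < h) (hr : h <= r).

Lemma bump_scaled_out x : h <= `|x - x0| -> bump_fun m.+2 ((x - x0) / h) = 0.
Proof.
by move=> hx; rewrite bump_out// normrM normfV (gtr0_norm h0) ler_pdivlMr// mul1r.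
Qed.

Lemma bump_density_ge0 x : 0 <= bump_density h x.
Proof.
apply: mulr_ge0; first exact: mulr_ge0 (mulr_ge0 (ltW c0) (powR_ge0 _ _)) (bump_ge0 _ _).
by rewrite invr_ge0 le_max normr_ge0.
Qed.

Lemma bump_density_le x : bump_density h x <= c * h `^ beta / r.
Proof.
rewrite /bump_density ler_pM//.
- exact: mulr_ge0 (mulr_ge0 (ltW c0) (powR_ge0 _ _)) (bump_ge0 _ _).
- by rewrite invr_ge0 le_max normr_ge0.
- by rewrite ler_piMr ?bump_le1// mulr_ge0 ?powR_ge0// ltW.
- by rewrite lef_pV2 ?posrE// ?lt_max ?r0 ?orbT// le_max lexx orbT.
Qed.

Lemma measurable_bump_density : measurable_fun setT (bump_density h).
Proof.
apply: measurable_funM; first by apply: measurable_funM => //; exact: measurable_bump.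
by apply: measurable_inv_max => //; exact: measurableT_comp.
Qed.

Lemma bump_density_out x : h <= `|x - x0| -> bump_density h x = 0.
Proof. by move=> hx; rewrite /bump_density bump_scaled_out// mulr0 mul0r. Qed.

Lemma finite_bump_density : finite_density (bump_density h).
Proof.
split; [exact: measurable_bump_density|exact: bump_density_ge0|].
apply: (@integrable_supported _ x0 h (c * h `^ beta / r) measurable_bump_density _ _ h0).1.
  by move=> x; rewrite ger0_norm ?bump_density_ge0// bump_density_le.
exact: bump_density_out.
Qed.

(** On the support |x - x0| < r = |x0| / 2, so |x| > r and x has the sign of [x0], whence x / |x| =
    [Num.sg x0]. The factor [h ^+ 0] matches the zeroth member of a scaled chain. *)
Lemma bump_densityE x : x * bump_density h x =
  Num.sg x0 * c * h `^ beta / h ^+ 0 * bump_fun m.+2 ((x - x0) / h).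
Proof.
rewrite expr0 divr1.
have [hx|xh] := leP h `|x - x0|.
  by rewrite bump_density_out// bump_scaled_out// !mulr0.
have rx : `|x - x0| < r by rewrite (lt_le_trans xh).
have tri : `|x0| <= `|x - x0| + `|x|.
  have -> : `|x0| = `|- (x - x0) + x| by congr (`| _ |); ring.
  by rewrite (le_trans (ler_normD _ _))// normrN.
have rE2 : `|x0| = r + r by rewrite rE; field.
rewrite /bump_density max_l; last by lra.
have xn0 : `|x| != 0 by apply: lt0r_neq0; move: r0; lra.
have -> : Num.sg x0 = x / `|x|.
  have xn : x != 0 by rewrite -normr_eq0.
  rewrite -{1}[x]mulr_sg_norm mulfK//.
  move: rx; rewrite ltr_norml rE => /andP[l1 l2].
  have [p|p|p] := ltrgt0P x0; last by move: x00; rewrite p eqxx.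
    by rewrite gtr0_sg// gtr0_sg//; move: l1; rewrite gtr0_norm//; lra.
  by rewrite ltr0_sg// ltr0_sg//; move: l2; rewrite ltr0_norm//; lra.
ring.
Qed.

End one_density.

Section pair.
Variable h : R.
Hypotheses (h0 : 0 < h) (hr : h <= r / 2).

(** Minimum of the wide bump on the inner half of its support, which contains the support of the
    narrow bump because [h <= r / 2]; 3/4 is 1 - (1/2)^2. *)
Let q : R := (3 / 4) ^+ m.+2.
Let q0 : 0 < q. Proof. by rewrite exprn_gt0. Qed.

(* phi = N_h / N_r, the denominator being truncated outside the support of N_h. *)
Let phi x : R := h `^ beta / r `^ beta * (bump_fun m.+2 ((x - x0) / h) / Num.max (bump_fun m.+2 ((x - x0) / r)) q).

Let phi_ge0 x : 0 <= phi x.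
Proof.
rewrite mulr_ge0// divr_ge0 ?powR_ge0 ?bump_ge0//.
by rewrite le_max (ltW q0) orbT.
Qed.

Let phi_le x : phi x <= h `^ beta / r `^ beta / q.
Proof.
rewrite /phi ler_wpM2l ?divr_ge0 ?powR_ge0// -[leRHS]mul1r ler_pM ?bump_ge0 ?bump_le1//.
  by rewrite invr_ge0 le_max (ltW q0) orbT.
by rewrite lef_pV2 ?posrE// ?lt_max ?q0 ?orbT// le_max lexx orbT.
Qed.

Let measurable_phi : measurable_fun setT phi.
Proof.
apply: measurable_funM => //; apply: measurable_funM; first exact: measurable_bump.
by apply: measurable_inv_max => //; exact: measurable_bump.
Qed.

Let phiE x : bump_density h x = phi x * bump_density r x.
Proof.
have [hx|xh] := leP h `|x - x0|.
  by rewrite bump_density_out// /phi bump_scaled_out// mul0r mulr0 mul0r.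
rewrite /bump_density /phi.
have qb : q <= bump_fun m.+2 ((x - x0) / r).
  apply: bump_inner; rewrite normrM normfV (gtr0_norm r0) ler_pdivrMr//.
  by rewrite mulrC; apply: (le_trans (ltW xh)).
rewrite (max_l qb).
have bn0 : bump_fun m.+2 ((x - x0) / r) != 0 by apply: lt0r_neq0; rewrite (lt_le_trans q0).
have rn0 : r `^ beta != 0 by rewrite gt_eqF// powR_gt0.
by field; rewrite bn0 rn0 gt_eqF// lt_max r0 orbT.
Qed.

(** Bound on [phi], times bound on the narrow density, times length of its support: of order h^(2
    beta + 1). *)
Let M : R := (h `^ beta / r `^ beta / q) * (c * h `^ beta / r) * (2 * h).

Let intM : leb.-integrable setT (EFin \o (fun x => phi x ^+ 2 * bump_density r x)) /\
  (\int[leb]_x (phi x ^+ 2 * bump_density r x)%:E <= M%:E)%E.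
Proof.
have E x : phi x ^+ 2 * bump_density r x = phi x * bump_density h x.
  by rewrite phiE; ring.
have pd0 x : 0 <= phi x * bump_density h x by exact: mulr_ge0 (phi_ge0 x) (bump_density_ge0 h x).
have [] := @integrable_supported (fun x => phi x ^+ 2 * bump_density r x) x0 h
  (h `^ beta / r `^ beta / q * (c * h `^ beta / r)) _ _ _ h0.
- apply: measurable_funM; first exact: measurable_funX.
  exact: measurable_bump_density.
- move=> x; rewrite E ger0_norm//; apply: ler_pM => //; [exact: bump_density_ge0|exact: bump_density_le].
- by move=> x hx; rewrite E bump_density_out ?mulr0.
move=> i1 i2; split => //; move: i2.
by under eq_integral do rewrite E ger0_norm// -E.
Qed.

Let N1 x : R := bump_density r x + bump_density h x.

Lemma finite_pair_density : finite_density N1.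
Proof.
have [m1 p1 i1] := finite_bump_density r0.
have [m2 p2 i2] := finite_bump_density h0.
split; [exact: measurable_funD|by move=> x; rewrite addr_ge0|].
by have := integrableD measurableT i1 i2.
Qed.

Lemma cpoisson_pair_sqr_le (D : R) f : 0 <= D -> nnmeas f ->
  (cpoisson D N1 f * cpoisson D N1 f <=
   (expR (D * M))%:E * cpoisson D (bump_density r) (fun z => f z * f z))%E.
Proof.
move=> D0 mf.
have f0 := finite_bump_density r0; have f1 := finite_bump_density h0.
have [m0 p0 i0] := f0; have [m1 p1 i1] := f1.
have [iM leM] := intM.
pose F x : R := 1 + phi x.
have N1E : N1 = fun x => F x * bump_density r x.
  by apply/funext => x; rewrite /N1 phiE /F mulrDl mul1r.
have massN1 : mass N1 = mass (bump_density r) + mass (bump_density h).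
  by rewrite /mass /N1 RintegralD.
have M0 : 0 < M.
  have := powR_gt0 beta h0; have := powR_gt0 beta r0 => p1' p2'.
  by rewrite /M !mulr_gt0// ?invr_gt0// ?divr_gt0.
have mass0 : 0 <= mass (bump_density r) by apply: Rintegral_ge0 => x _; exact: p0.
have mass1 : 0 <= mass (bump_density h) by apply: Rintegral_ge0 => x _; exact: p1.
(* Expanding (1 + phi)^2 against the wide density gives its mass, twice the mass of the narrow
   density, and a term at most [M]. In the exponent of [cpoisson_sqr_le] the masses cancel and only
   [M] remains. *)
pose K := mass (bump_density r) + 2 * mass (bump_density h) + M.
have K0 : 0 < K by rewrite /K; lra.
have mF : measurable_fun setT F by exact: measurable_funD.
have F0 x : 0 <= F x by rewrite addr_ge0.
have KF : (\int[leb]_y (F y ^+ 2 * bump_density r y)%:E <= K%:E)%E.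
  have iE (g : R -> R) : leb.-integrable setT (EFin \o g) ->
      (\int[leb]_y (g y)%:E = (Rintegral leb setT g)%:E)%E.
    by move=> gi; rewrite /Rintegral fineK//; exact: (integrable_fin_num measurableT gi).
  have i2 : leb.-integrable setT (EFin \o (fun x => 2 * bump_density h x)).
    by have := integrableZl measurableT 2 i1.
  have i02 : leb.-integrable setT (EFin \o (fun x => bump_density r x + 2 * bump_density h x)).
    by have := integrableD measurableT i0 i2.
  have i3 : leb.-integrable setT (EFin \o (fun x => bump_density r x + 2 * bump_density h x + phi x ^+ 2 * bump_density r x)).
    by have := integrableD measurableT i02 iM.
  have -> : (\int[leb]_y (F y ^+ 2 * bump_density r y)%:E = (\int[leb]_y (bump_density r y + 2 * bump_density h y + phi y ^+ 2 * bump_density r y)%:E))%E.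
    by apply: eq_integral => y _; rewrite phiE /F; congr EFin; ring.
  rewrite (iE _ i3) lee_fin RintegralD// RintegralD// RintegralZl// /K lerD2l.
  by move: leM; rewrite (iE _ iM) lee_fin.
have fN1 : finite_density (fun x => F x * bump_density r x).
  by rewrite -N1E; exact: finite_pair_density.
have := cpoisson_sqr_le f0 mF F0 fN1 K0 KF D0 mf.
rewrite -N1E massN1 /K.
by have -> : mass (bump_density r) + 2 * mass (bump_density h) + M + mass (bump_density r) -
  2 * (mass (bump_density r) + mass (bump_density h)) = M by ring.
Qed.

End pair.
End hypotheses_pair.

(** * Hypotheses in the Hölder class, and the lower bound *)

Section hypotheses.
Context (R : realType).
Notation leb := (@lebesgue_measure R).

Lemma admissible_finite_density (beta L : R) (N : R -> R) : finite_density N ->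
  leb.-integrable setT (fun x => (x * N x)%:E) ->
  holder_class beta L (fun x => x * N x) -> admissible beta L N.
Proof.
move=> [mN N0 iN] ixN hN; split => //; split => //; split => //.
apply: (le_integrable measurableT _ _ iN).
  apply/measurable_EFinP/measurable_funM => //.
  by apply: measurable_minr => //; exact: measurable_funX.
move=> x _ /=; rewrite lee_fin normrM ler_piMl// ger0_norm ?ge_min ?lexx//.
by rewrite le_min ler01 sqr_ge0.
Qed.

Lemma holder_chain_le l (g L L' : R) F : L <= L' -> holder_chain l g L F ->
  holder_chain l g L' F.
Proof.
move=> LL' [dF hF]; split => // x y.
by rewrite (le_trans (hF x y))// ler_wpM2r// powR_ge0.
Qed.

Lemma exists_hypotheses (beta L x0 : R) : 0 < beta -> 0 < L -> x0 != 0 ->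
  exists c r B : R, [/\ 0 < c, 0 < r & 0 <= B] /\
  exists (N0 : R -> R) (N1 : R -> R -> R), finite_density N0 /\ admissible beta L N0 /\
    forall h, 0 < h -> h <= r ->
    [/\ finite_density (N1 h), admissible beta L (N1 h),
      `|x0 * N1 h x0 - x0 * N0 x0| = c * h `^ beta &
      forall D f, 0 <= D -> nnmeas f ->
      (cpoisson D (N1 h) f * cpoisson D (N1 h) f <=
       (expR (D * (B * h `^ (2 * beta + 1))))%:E * cpoisson D N0 (fun z => f z * f z))%E].
Proof.
move=> b0 L0 x00.
set l := lfloor beta.
have [g0 g1] := lfloorP b0.
have [Lc Lc0 ch] := bump_holder_chain l g0 g1.
(* Half of the Hölder budget [L] goes to each bump, so that their sum stays in the class. *)
pose r := `|x0| / 2; pose c := L / (2 * Lc).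
have r0 : 0 < r by rewrite divr_gt0// normr_gt0.
have c0 : 0 < c by rewrite divr_gt0// mulr_gt0.
pose N := bump_density l x0 c beta r.
have fN h : 0 < h -> finite_density (N h) by exact: finite_bump_density.
pose F h k x := Num.sg x0 * c * h `^ beta / h ^+ k * bumpW (bump_poly R l.+2 k) (l.+2 - k) ((x - x0) / h).
have FN h x : 0 < h -> h <= r -> F h 0%N x = x * N h x.
  move=> h0 hr; rewrite (bump_densityE l c beta x00 (erefl r) h0 hr).
  by rewrite /F /bumpW /= subn0 hornerC mul1r.
have absN h : `|Num.sg x0 * c * h `^ beta| = c * h `^ beta.
  by rewrite normrM (ger0_norm (powR_ge0 _ _)) normrM (gtr0_norm c0) normr_sg x00 mul1r.
have chF h : 0 < h -> holder_chain l (beta - l%:R) (L / 2) (F h).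
  move=> h0.
  have := @scaled_holder_chain R l _ _ (Num.sg x0 * c * h `^ beta) x0 h _ h0 ch.
  apply: holder_chain_le.
  have -> : l%:R + (beta - (lfloor beta)%:R) = beta by rewrite -/l; ring.
  rewrite absN mulfK ?gt_eqF ?powR_gt0// le_eqVlt; apply/orP; left; apply/eqP.
  by rewrite /c; field; rewrite gt_eqF.
have iN h : 0 < h -> h <= r -> leb.-integrable setT (fun x => (x * N h x)%:E).
  move=> h0 hr; have [mN _ _] := fN h h0.
  apply: (@integrable_supported _ (fun x => x * N h x) x0 h (c * h `^ beta) _ _ _ h0).1.
  - exact: measurable_funM.
  - move=> x; rewrite (bump_densityE l c beta x00 (erefl r) h0 hr) expr0 divr1.
    by rewrite normrM absN (ger0_norm (bump_ge0 _ _)) ler_piMr ?bump_le1// mulr_ge0 ?powR_ge0// ltW.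
  - by move=> x hx; rewrite /N bump_density_out ?mulr0.
(* The admissible widths stop at half the width of the fixed bump, and the third witness is the
   coefficient of h^(2 beta + 1) in the chi-square bound. *)
exists c, (r / 2), (2 * c / (r `^ beta * (3 / 4) ^+ l.+2 * r)); split.
  split => //; first by rewrite divr_gt0.
  have q0 : 0 < (3 / 4 : R) ^+ l.+2 by rewrite exprn_gt0.
  apply: divr_ge0; first exact: mulr_ge0 (ler0n _ 2) (ltW c0).
  exact: mulr_ge0 (mulr_ge0 (powR_ge0 _ _) (ltW q0)) (ltW r0).
exists (N r), (fun h x => N r x + N h x); split; first exact: fN.
split.
  apply: admissible_finite_density; [exact: fN|exact: iN|].
  have -> : (fun x => x * N r x) = F r 0%N by apply/funext => x; rewrite FN.
  apply: holder_class_chain; apply: holder_chain_le (chF r r0).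
  by rewrite ler_pdivrMr// ler_peMr ?(ltW L0)// ler1n.
move=> h h0 hr2.
have hr : h <= r by rewrite (le_trans hr2)// ler_pdivrMr// ler_peMr ?(ltW r0)// ler1n.
have fN1 : finite_density (fun x => N r x + N h x).
  exact: (finite_pair_density l beta x00 c0 (erefl r) h0).
split; first exact: fN1.
- apply: admissible_finite_density => //.
    have := integrableD measurableT (iN r r0 (lexx r)) (iN h h0 hr).
    by congr integrable; apply/funext => x; rewrite /= mulrDr EFinD.
  have -> : (fun x => x * (N r x + N h x)) = (fun x => F r 0%N x + F h 0%N x).
    by apply/funext => x; rewrite !FN// mulrDr.
  apply: (@holder_class_chain R beta L (fun k x => F r k x + F h k x)).
  apply: holder_chain_le (holder_chainD (chF r r0) (chF h h0)).
  by rewrite -splitr.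
- rewrite mulrDr addrC addKr (bump_densityE l c beta x00 (erefl r) h0 hr).
  by rewrite expr0 divr1 subrr mul0r bump0 mulr1 absN.
move=> D f D0 mf.
have := cpoisson_pair_sqr_le l beta x00 c0 (erefl r) h0 hr2 D0 mf.
congr (_ <= (expR (D * _))%:E * _)%E.
have hn0 : h != 0 by rewrite gt_eqF.
have -> : 2 * beta + 1 = beta + beta + 1 by ring.
rewrite !powRD ?hn0 ?implybT// powRr1 ?(ltW h0)//.
have rb0 : 0 < r `^ beta by exact: powR_gt0.
have q0 : 0 < (3 / 4 : R) ^+ l.+2 by rewrite exprn_gt0.
move: (r `^ beta) rb0 ((3 / 4 : R) ^+ l.+2) q0 => u u0 v v0.
by field; rewrite !gt_eqF.
Qed.

End hypotheses.

Unset Implicit Arguments.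

Theorem theorem3p5 (R : realType) (beta L x0 : R) (Delta : nat -> R)
  (Plaw : R -> (R -> R) -> probability R R) :
  0 < beta -> 0 < L -> x0 != 0 ->
  (forall n, 0 < Delta n) ->
  (* Delta = O(1) and Delta^{-1} = O(n) *)
  (exists M : R, 0 < M /\ exists n1 : nat, forall n : nat, (n1 <= n)%N ->
      Delta n <= M /\ (Delta n)^-1 <= M * n%:R) ->
  (* Plaw D N is the law of the increment L_D of the Lévy process with density N *)
  (forall (D : R) (N : R -> R), 0 < D -> admissible beta L N ->
      levy_increment_law D N (Plaw D N)) ->
  exists C : R, 0 < C /\ exists n0 : nat, forall n : nat, (n0 <= n)%N ->
    forall ghat : n.-tuple R -> R, measurable_fun setT ghat ->
      ((C * (n%:R * Delta n) `^ (- (2 * beta / (2 * beta + 1))))%:E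
       <= ereal_sup [set iid_expect (Plaw (Delta n) N)
                          (fun t => ((ghat t - x0 * N x0) ^+ 2)%:E)
                    | N in admissible beta L])%E.
Proof.
move=> b0 L0 x00 D0 [M [M0 [n1 HM]]] HP.
have [c [r [B [[c0 r0 B0] [N0 [N1 [fN0 [aN0 HN1]]]]]]]] := exists_hypotheses b0 L0 x00.
pose s : R := 2 * beta + 1.
have s0 : 0 < s by rewrite /s; lra.
(* Chosen so that h = c1 (n Delta)^(- 1/s) is at most [r] whenever 1 / (n Delta) <= M. *)
pose c1 := r / M `^ s^-1.
have c10 : 0 < c1 by rewrite divr_gt0// powR_gt0.
(* Since n Delta h^s = c1^s, this bounds the n-th power of the one-observation constant, uniformly
   in n. *)
pose A := expR (B * c1 `^ s).
have A1 : 1 <= A by rewrite -expR0 ler_expR mulr_ge0// powR_ge0.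
have A0 : 0 < A by exact: expR_gt0.
exists ((c * c1 `^ beta) ^+ 2 / (16 * A)); split.
  have d0 : 0 < c * c1 `^ beta by rewrite mulr_gt0// powR_gt0.
  by rewrite divr_gt0 ?(exprn_gt0 2 d0)// mulr_gt0.
(* Requiring n >= 1 makes n Delta positive, so that the powers and inverses below behave. *)
exists (maxn n1 1) => n; rewrite geq_max => /andP[n1n n0] ghat mghat.
have [_ HD] := HM n n1n; have Dn := D0 n.
have nR : 0 < n%:R :> R by rewrite ltr0n.
pose T := n%:R * Delta n.
have T0 : 0 < T by rewrite mulr_gt0.
have TM : T^-1 <= M by rewrite /T invfM ler_pdivrMl// mulrC.
pose h := c1 * T `^ (- s^-1).
have h0 : 0 < h by rewrite mulr_gt0// powR_gt0.
have hr : h <= r.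
  rewrite /h /c1 mulrAC ler_pdivrMr ?powR_gt0// ler_pM2l//.
  have -> : T `^ (- s^-1) = T^-1 `^ s^-1 by rewrite -[T^-1]powR_inv1 ?(ltW T0)// -powRrM mulN1r.
  by rewrite ge0_ler_powR ?nnegrE ?invr_ge0 ?(ltW T0) ?(ltW M0) ?(ltW s0).
have hs : T * h `^ s = c1 `^ s.
  rewrite /h powRM ?powR_ge0 ?(ltW c10)// -powRrM mulNr mulVf ?gt_eqF//.
  by rewrite powR_inv1 ?(ltW T0)// mulrCA mulfV ?gt_eqF// mulr1.
have [fN1 aN1 delta chi2] := HN1 h h0 hr.
have hb : h `^ beta = c1 `^ beta * T `^ (- (beta / s)).
  by rewrite /h powRM ?powR_ge0 ?(ltW c10)// -powRrM mulNr [s^-1 * _]mulrC.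
have -> : (c * c1 `^ beta) ^+ 2 / (16 * A) * T `^ (- (2 * beta / (2 * beta + 1))) =
    (c * h `^ beta) ^+ 2 / (16 * A).
  have -> : T `^ (- (2 * beta / (2 * beta + 1))) = (T `^ (- (beta / s))) ^+ 2.
    by rewrite -powR_mulrn ?powR_ge0// -powRrM; congr (_ `^ _); rewrite -/s; ring.
  by rewrite hb; ring.
have L1 := integral_levy_law fN1 (ltW Dn) (HP _ _ Dn aN1).
have L2 := integral_levy_law fN0 (ltW Dn) (HP _ _ Dn aN0).
have H : forall f : R -> \bar R, nnmeas f ->
    (\int[Plaw (Delta n) (N1 h)]_x f x * \int[Plaw (Delta n) (N1 h)]_x f x <=
    (expR (Delta n * (B * h `^ s)))%:E * \int[Plaw (Delta n) N0]_x (f x * f x))%E.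
  move=> f mf; rewrite L1// L2; last exact: nnmeas_mul.
  exact: chi2 (ltW Dn) mf.
have KA : expR (Delta n * (B * h `^ s)) ^+ n <= A.
  rewrite -expRM_natl /A ler_expR.
  have -> : n%:R * (Delta n * (B * h `^ s)) = B * (T * h `^ s) by rewrite /T; ring.
  by rewrite hs.
have ch0 : 0 < c * h `^ beta by rewrite mulr_gt0// powR_gt0.
have dl : c * h `^ beta <= `|x0 * N1 h x0 - x0 * N0 x0| by rewrite delta.
have [le0|le1] := two_point_risk (expR_ge0 _) A1 ch0 KA dl H mghat.
  by apply: (le_trans le0); apply: ereal_sup_ubound; exists N0.
by apply: (le_trans le1); apply: ereal_sup_ubound; exists (N1 h).
Qed.
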